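(* Let $\varphi$ be a tame, discrete, regular Langlands parameter for the quasi-split ramified unitary group $\mathbf{G}$, normalized so that $\varphi(\tilde\tau)=z\tau$ with $z\in\hat{\mathbf{S}}^\tau$, and suppose that $Z_{\hat{\mathbf{G}}}(\varphi(\tilde\tau))=\hat{\mathbf{S}}^\tau$. Then the character $\chi_\varphi$ of $\mathbf{T}(K)^0$ is in general position: the only $\mathrm{Fr}$-invariant element of the Weyl group $W_{\mathbf{T}}^I$ of $\bar{\mathbf{T}}$ fixing $\chi_\varphi$ is the identity.
   Context: $K/\mathbb{Q}_p$ is a finite extension, $p\neq2$; $E/K$ is a ramified quadratic extension, $\mathrm{Gal}(E/K)=\{1,\tau\}$; $\mathbf{G}=\mathrm{U}(V)$ is a quasi-split unitary group of an $n$-dimensional Hermitian space $V$ over $E$; $\mathbf{S}$ is the centralizer of a maximal $K$-split torus; $W$ is its Weyl group; $I$ is the inertia group of $K$, acting on $W$ through $\mathrm{Gal}(E/K)$, so $W^I=W^\tau$. $\hat{\mathbf{G}}=\mathrm{GL}_n(\mathbb{C})$ with maximal torus $\hat{\mathbf{S}}$ dual to $\mathbf{S}$, $\tau$ acts by the automorphism preserving a pinning, ${}^L\mathbf{G}=\hat{\mathbf{G}}\rtimes\mathrm{Gal}(E/K)$, and $W=N_{\hat{\mathbf{G}}}(\hat{\mathbf{S}})/\hat{\mathbf{S}}$. $\tilde\tau$ is a topological generator of tame inertia mapping to $\tau$; $\mathrm{Fr}$ is a Frobenius element of the tame Weil group acting trivially on $E$. A Langlands parameter $\varphi\colon\mathcal{W}_K\to{}^L\mathbf{G}$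 (compatible with projection to $\mathrm{Gal}(E/K)$) is tame if trivial on wild inertia, discrete if its centralizer in $\hat{\mathbf{G}}$ is finite (modulo the center of ${}^L\mathbf{G}$), regular if $\varphi(\tilde\tau)$ is semisimple with $Z_{\hat{\mathbf{G}}}(\varphi(\tilde\tau))$ conjugate to $\hat{\mathbf{S}}^\tau$. With the normalization $z\in\hat{\mathbf{S}}^\tau$, $\varphi(\mathrm{Fr})\in N_{\hat{\mathbf{G}}}(\hat{\mathbf{S}})$; its image in $W$ is $\omega\in W^I$. $\mathbf{T}$ is the (anisotropic) $K$-torus with $X^*(\mathbf{T})=X^*(\mathbf{S})$, inertia acting as on $X^*(\mathbf{S})$ and $\mathrm{Fr}$ acting by $\omega$. $M$ is its splitting field and $K_f$ the maximal unramified subextension of $M/K$. $\mathbf{T}(N)^0$ (for $N/K$ finite unramified) is the group of integral points of the identity component of the Néron model. Identify $\hat{\mathbf{T}}=\hat{\mathbf{S}}$. The restriction of $\varphi$ to $\mathcal{W}_{K_f}$ takes values in $\hat{\mathbf{T}}\rtimes\mathrm{Gal}(E/K)\cong\hat{\mathbf{T}}\rtimes\mathrm{Gal}(M/K_f)$ and so defines a class in $H^1(\mathcal{W}_{K_f},\hat{\mathbf{T}})^{\mathrm{Gal}(K_f/K)}$, hence by the local Langlands correspondence for tori a $\mathrm{Gal}(K_f/K)$-invariant character of $\mathbf{T}(K_f)$. Its restriction to $\mathbf{T}(K_f)^0$ factors uniquely through the norm isomorphism $\mathbf{T}(K_f)^0_{\mathrm{Gal}(K_f/K)}\cong\mathbf{T}(K)^0$;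 the resulting character of $\mathbf{T}(K)^0$ is $\chi_\varphi$. It factors through $\bar{\mathbf{T}}(k)=\mathbf{T}(K)^0/\mathbf{T}(K)^{0+}$ (Moy–Prasad filtration). The Weyl group $W_{\mathbf{T}}$ is $W$ acting on $X^*(\mathbf{T})=X^*(\mathbf{S})$; the Weyl group of $\bar{\mathbf{T}}$ is identified with $W_{\mathbf{T}}^I=W^\tau$, on which $\mathrm{Fr}$ acts by conjugation by $\omega$. An $\mathrm{Fr}$-invariant element (one commuting with $\omega$) acts on $X^*(\mathbf{T})$ Galois-equivariantly, hence as a $K$-automorphism of $\mathbf{T}$, and so acts on $\mathbf{T}(K)^0$ and its characters. *)

(* Defs.v *)
From HB Require Import structures.
From mathcomp Require Import all_boot all_order all_algebra all_fingroup.
From mathcomp Require Import all_classical all_reals.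
From mathcomp Require Import complex.

Set Implicit Arguments.
Unset Strict Implicit.
Unset Printing Implicit Defensive.

Import Order.TTheory GRing.Theory Num.Theory.
Local Open Scope classical_set_scope.
Local Open Scope ring_scope.

Record fieldAut (L : fieldType) := FieldAut {
  aut_fun :> L -> L;
  aut_inv : L -> L;
  aut_funK : cancel aut_fun aut_inv;
  aut_invK : cancel aut_inv aut_fun;
  aut_funD : {morph aut_fun : x y / x + y};
  aut_funM : {morph aut_fun : x y / x * y};
  aut_fun1 : aut_fun 1 = 1 }.

Section FieldAutGroup.
Variable L : fieldType.
Implicit Types s t : fieldAut L.

Lemma fieldAut_eq s t : s =1 t -> s = t.
Proof.
case: s t => [f f' fK f'K fD fM f1] [g g' gK g'K gD gM g1] /= /funext efg.
subst g; have /funext e : f' =1 g' by move=> x; apply: (can_inj gK); rewrite f'K g'K.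
by subst g'; congr FieldAut; exact: Prop_irrelevance.
Qed.

Definition aut_one : fieldAut L.
Proof. by exists id id. Defined.

Definition aut_mul s t : fieldAut L.
Proof.
exists (s \o t) (aut_inv t \o aut_inv s) => [x|x|x y|x y|] /=.
- by rewrite !aut_funK.
- by rewrite !aut_invK.
- by rewrite !aut_funD.
- by rewrite !aut_funM.
- by rewrite !aut_fun1.
Defined.

Definition aut_invg s : fieldAut L.
Proof.
exists (aut_inv s) s => [x|x|x y|x y|].
- exact: aut_invK.
- exact: aut_funK.
- by apply: (can_inj (aut_funK s)); rewrite aut_funD !aut_invK.
- by apply: (can_inj (aut_funK s)); rewrite aut_funM !aut_invK.
- by apply: (can_inj (aut_funK s)); rewrite aut_fun1 !aut_invK.
Defined.

Fact aut_mulA : associative aut_mul.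
Proof. by move=> s t u; apply: fieldAut_eq. Qed.
Fact aut_mul1 : left_id aut_one aut_mul.
Proof. by move=> s; apply: fieldAut_eq. Qed.
Fact aut_mulr1 : right_id aut_one aut_mul.
Proof. by move=> s; apply: fieldAut_eq. Qed.
Fact aut_mulV : left_inverse aut_one aut_invg aut_mul.
Proof. by move=> s; apply: fieldAut_eq => x /=; rewrite aut_funK. Qed.
Fact aut_mulrV : right_inverse aut_one aut_invg aut_mul.
Proof. by move=> s; apply: fieldAut_eq => x /=; rewrite aut_invK. Qed.

HB.instance Definition _ := gen_eqMixin (fieldAut L).
HB.instance Definition _ := gen_choiceMixin (fieldAut L).
HB.instance Definition _ := isGroup.Build (fieldAut L)
  aut_mulA aut_mul1 aut_mulr1 aut_mulV aut_mulrV.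

End FieldAutGroup.

Section LocalFields.
Variables (R : realType) (L : closedFieldType) (abs : L -> R) (p : nat).
Local Notation gal := (fieldAut L).
Implicit Types (N : set L) (s g : gal).

(* Q_p inside L: the closure of Q. *)
Definition Qp : set L :=
  [set x | forall e : R, 0 < e -> exists r : rat, abs (x - ratr r) < e].

(* L is an algebraic closure of Q_p, with its extended p-adic absolute
   value.  [abs_p] forces the restriction of abs to Q to be the p-adic one. *)
Record padic_closure : Prop := PadicClosure {
  abs_ge0 : forall x, 0 <= abs x;
  abs_eq0 : forall x, abs x = 0 <-> x = 0;
  absM : forall x y, abs (x * y) = abs x * abs y;
  abs_ultra : forall x y, abs (x + y) <= Num.max (abs x) (abs y);
  abs_p : abs p%:R = p%:R^-1;
  Qp_complete : forall u : nat -> rat,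
    (forall e : R, 0 < e -> exists m0 : nat, forall m k : nat,
        (m0 <= m)%N -> (m0 <= k)%N -> abs (ratr (u m) - ratr (u k)) < e) ->
    exists x, forall e : R, 0 < e -> exists m0 : nat, forall m : nat,
        (m0 <= m)%N -> abs (ratr (u m) - x) < e;
  Qp_algebraic : forall x, exists P : {poly L},
    [/\ P != 0, forall i, Qp P`_i & root P x] }.

Definition is_subfield N :=
  N 1 /\ forall x y, N x -> N y -> N (x - y) /\ N (x / y).

(* finite extensions of Q_p *)
Definition padic_field N :=
  [/\ is_subfield N, Qp `<=` N
    & exists b : seq L, (forall y, y \in b -> N y) /\
      forall x, N x -> exists c : nat -> L,
        (forall i, Qp (c i)) /\ x = \sum_(i < size b) c i * b`_i].

Definition Oint N : set L := [set x | N x /\ abs x <= 1].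

Definition uniformizer N (pi : L) :=
  [/\ N pi, pi != 0, abs pi < 1
    & forall x, N x -> abs x < 1 -> abs x <= abs pi].

(* the residue field of N has q elements *)
Definition residue_card N (q : nat) :=
  exists t : q.-tuple L, (forall i, Oint N (tnth t i)) /\
    forall x, Oint N x -> exists! i : 'I_q, abs (x - tnth t i) < 1.

Definition ramified_quadratic K E :=
  [/\ padic_field K /\ padic_field E, K `<=` E,
      exists a, [/\ E a, ~ K a
        & forall x, E x -> exists b c, [/\ K b, K c & x = b + c * a]]
    & exists x, [/\ E x, x != 0 & forall y, K y -> abs y != abs x]].

Definition fixes N s := forall x, N x -> s x = x.

(* s acts on the residue field of L as the k-th power of x |-> x ^ q *)
Definition frob_pow (q : nat) s (k : int) :=
  forall x, abs x <= 1 ->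
    match k with
    | Posz m => abs (s x - x ^+ (q ^ m)) < 1
    | Negz m => abs (s x ^+ (q ^ m.+1) - x) < 1
    end.

(* The residue field of N being finite, an element of Gal(L/N) acts on the
   residue field by an integral power of the q_N-Frobenius iff it does so by
   an integral power of the p-Frobenius. *)
Definition weil N : set gal :=
  [set s | fixes N s /\ exists k : int, frob_pow p s k].

Definition inertia N : set gal :=
  [set s | fixes N s /\ forall x, abs x <= 1 -> abs (s x - x) < 1].

Definition wild_inertia N : set gal :=
  [set s | inertia N s /\ forall x, x != 0 -> abs (s x / x - 1) < 1].

(* t, in inertia, is a topological generator of inertia / wild inertia, i.e.
   of the inertia group of the fixed field of wild inertia. *)
Definition tame_inertia_generator N t :=
  inertia N t /\
  forall s (xs : seq L), inertia N s ->
    (forall x, x \in xs -> forall w, wild_inertia N w -> w x = x) ->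
    exists m : nat, forall x, x \in xs -> (t ^+ m)%g x = s x.

Definition finite_abelian N N' :=
  [/\ padic_field N', N `<=` N'
    & forall s, fixes N s -> (forall x, N' x -> N' (s x)) /\
      forall s', fixes N s' -> forall x, N' x -> s (s' x) = s' (s x)].

(* rs is a system of representatives of the left cosets G / H *)
Definition transversal (G H : set gal) (rs : seq gal) :=
  (forall r, r \in rs -> G r) /\
  forall g, G g -> exists! i : 'I_(size rs), H ((nth 1 rs i)^-1 * g)%g.

(* the representative in rs of gH *)
Definition coset_rep (H : set gal) (rs : seq gal) g : gal :=
  nth 1%g rs (find (fun r => `[< H (r^-1 * g)%g >]) rs).

(* rec N : W_N -> N^* is the local reciprocity map, inducing W_N^ab ~ N^*,
   for every finite extension N of Q_p.  The homomorphism property, [rec_frob]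
   and [rec_norm] already determine the family.  Both normalizations are
   allowed: arithmetic (geom = false) or geometric (geom = true) Frobenius
   elements correspond to uniformizers. *)
Record reciprocity (geom : bool) (rec : set L -> gal -> L) : Prop :=
 Reciprocity {
  rec_mem : forall N s, padic_field N -> weil N s ->
    N (rec N s) /\ rec N s != 0;
  recM : forall N s s', padic_field N -> weil N s -> weil N s' ->
    rec N (s * s')%g = rec N s * rec N s';
  rec_surj : forall N x, padic_field N -> N x -> x != 0 ->
    exists s, weil N s /\ rec N s = x;
  rec_ker : forall N s, padic_field N -> weil N s ->
    (rec N s = 1 <-> forall N', finite_abelian N N' -> fixes N' s);
  rec_frob : forall N q pi s k, padic_field N -> residue_card N q ->
    uniformizer N pi -> weil N s -> frob_pow q s k ->
    abs (rec N s) = abs pi ^ (if geom then - k else k);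
  rec_norm : forall N N' rs s, padic_field N -> padic_field N' ->
    N `<=` N' -> transversal (weil N) (weil N') rs -> weil N' s ->
    rec N s = \prod_(r <- rs) r (rec N' s);
  rec_conj : forall N g s, padic_field N -> fixes Qp g -> weil N s ->
    rec [set g x | x in N] (g * s * g^-1)%g = g (rec N s) }.

End LocalFields.

Section Tori.
Variables (R : realType) (L : closedFieldType) (abs : L -> R) (p n : nat).
Local Notation gal := (fieldAut L).
Local Notation XX := 'cV[int]_n. (* characters *)
Local Notation YY := 'rV[int]_n. (* cocharacters *)
(* The Weil group acts on X^* = Z^n by l |-> rho s *m l, hence on the dual
   lattice X_* by x |-> x *m rho s^-1. *)
Variable rho : gal -> 'M[int]_n.
Implicit Types (N : set L) (s : gal) (l : XX).

(* A-points of the split torus Hom(X^*, G_m) *)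
Definition split_point (A : comNzRingType) (t : XX -> A) :=
  t 0 = 1 /\ forall l l', t (l + l') = t l * t l'.

(* T(N) = Hom(X^*, L^* )^{W_N}, which is the set of Gal(L/N)-invariants
   because W_N is dense and acts on X^* and L with finite orbits. *)
Definition torus_points N : set (XX -> L) :=
  [set t | split_point t /\
           forall s, weil abs p N s -> forall l, s (t l) = t (rho s *m l)].

Definition torus_norm (rs : seq gal) (t : XX -> L) : XX -> L :=
  fun l => \prod_(r <- rs) r (t (rho r^-1%g *m l)).

(* structure map of an algebra over the ring of integers of N *)
Definition Oalg N (A : comNzRingType) (a : L -> A) :=
  a 1 = 1 /\ forall x y, Oint abs N x -> Oint abs N y ->
    a (x + y) = a x + a y /\ a (x * y) = a x * a y.

Definition finite_type N (B : comNzRingType) (a : L -> B) :=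
  exists gs : seq B, forall S : set B,
    (forall x, Oint abs N x -> S (a x)) -> (forall b, b \in gs -> S b) ->
    (forall b c, S b -> S c -> S (b + c) /\ S (b * c)) -> forall b, S b.

Definition formally_smooth N (B : comNzRingType) (a : L -> B) :=
  forall (D D' : comNzRingType) (pr : {rmorphism D -> D'}) (d : L -> D)
         (f : {rmorphism B -> D'}),
    (forall y, exists x, pr x = y) ->
    (forall x y, pr x = 0 -> pr y = 0 -> x * y = 0) ->
    Oalg N d -> (forall x, Oint abs N x -> f (a x) = pr (d x)) ->
    exists g : {rmorphism B -> D},
      (forall b, pr (g b) = f b) /\ (forall x, Oint abs N x -> g (a x) = d x).

(* Finite type is the same as finite presentation, O_N being noetherian. *)
Definition smooth_algebra N (B : comNzRingType) (a : L -> B) :=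
  [/\ Oalg N a, finite_type N a & formally_smooth N a].

(* Spec (B / m_N B) is connected *)
Definition connected_special_fibre N (B : comNzRingType) (a : L -> B) :=
  forall pi, uniformizer abs N pi ->
    (forall b, 1 <> a pi * b) /\
    forall e : B, (exists b, e * e - e = a pi * b) ->
      (exists b, e = a pi * b) \/ (exists b, 1 - e = a pi * b).

(* B' = L (x)_{O_N} B *)
Definition base_change N (B B' : comNzRingType) (a : L -> B)
    (i : {rmorphism B -> B'}) (j : {rmorphism L -> B'}) :=
  (forall x, Oint abs N x -> i (a x) = j x) /\
  forall (D : comNzRingType) (f : {rmorphism B -> D}) (g : {rmorphism L -> D}),
    (forall x, Oint abs N x -> f (a x) = g x) ->
    (exists h : {rmorphism B' -> D}, h \o i =1 f /\ h \o j =1 g) /\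
    (forall h h' : {rmorphism B' -> D},
       h \o i =1 h' \o i -> h \o j =1 h' \o j -> h =1 h').

(* For B smooth over O_N, the Neron mapping property says that the sections
   over Spec B of the Neron model of T are the elements of T(B (x) N), i.e.
   the points u of the split torus over B' = L (x) B which are equivariant for
   the semilinear action of Galois on B'. *)
Definition neron_section N (B B' : comNzRingType)
    (i : {rmorphism B -> B'}) (j : {rmorphism L -> B'}) (u : XX -> B') :=
  split_point u /\
  forall s, weil abs p N s -> forall S : {rmorphism B' -> B'},
    S \o i =1 i -> (forall x, S (j x) = j (s x)) ->
    forall l, S (u l) = u (rho s *m l).

(* T(N)^0, the integral points of the identity component of the Neron model:
   t in T(N), which is the set of all integral points of the Neron model,
   belongs to the identity component iff t and 1 are values, at integral points
   y1 and y0, of one section of the Neron model over a smooth affine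
   O_N-scheme Spec B with connected special fibre (the identity component is
   itself such a scheme). *)
Definition torus_points0 N : set (XX -> L) :=
  [set t | torus_points N t /\
    exists (B B' : comNzRingType) (a : L -> B) (i : {rmorphism B -> B'})
           (j : {rmorphism L -> B'}) (u : XX -> B')
           (y0 y1 : {rmorphism B' -> L}),
      [/\ smooth_algebra N a, connected_special_fibre N a,
          base_change N a i j, neron_section N i j u
        & [/\ (forall x, y0 (j x) = x) /\ (forall b, Oint abs N (y0 (i b))),
              (forall x, y1 (j x) = x) /\ (forall b, Oint abs N (y1 (i b))),
              forall l, y0 (u l) = 1
            & forall l, y1 (u l) = t l]]].

Definition splitting_field K M :=
  [/\ K `<=` M, padic_field abs M
    & forall s, weil abs p K s -> (fixes M s <-> rho s = 1%:M)].

(* M \cap K^nr, K^nr being the fixed field of the inertia group of K *)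
Definition max_unramified K M : set L :=
  [set y | M y /\ forall s, inertia abs K s -> s y = y].

(* Inhomogeneous 1-chains \sum_j w_j (x) x_j of W_F with values in X_* are
   represented by lists of pairs (w_j, x_j); the boundary of w (x) x is
   w^-1 x - x. *)
Definition cycle1 F (c : seq (gal * YY)) :=
  (forall e, e \in c -> weil abs p F e.1) /\
  \sum_(e <- c) (e.2 *m rho e.1 - e.2) = 0.

(* The transfer H_1(W_F, X_* ) -> H_1(W_M, X_* ) = W_M^ab (x) X_*, followed by
   the reciprocity isomorphism W_M^ab (x) X_* = M^* (x) X_* = T(M):
   w (x) x goes to \sum_r (s^-1 w r) (x) s^-1 x, where r runs through
   representatives of W_F / W_M and s is the representative of w r W_M. *)
Definition transfer_point (rec : set L -> gal -> L) M (rs : seq gal)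
    (c : seq (gal * YY)) : XX -> L :=
  fun l => \prod_(e <- c) \prod_(r <- rs)
    let s := coset_rep (weil abs p M) rs (e.1 * r)%g in
    rec M (s^-1 * e.1 * r)%g ^ ((e.2 *m rho s *m l) 0 0).

Definition is_character (C : fieldType) (A : set (XX -> L))
    (chi : (XX -> L) -> C) :=
  forall t t', A t -> A t' ->
    chi t != 0 /\ chi (fun l => t l * t' l) = chi t * chi t'.

(* The local Langlands correspondence for T over F, T being split by M:
   chi : T(F) -> C^* corresponds to the class of the 1-cocycle a of W_F with
   values in the dual torus (C^* )^n when the pairing of a with a 1-cycle is
   chi of the point of T(F) corresponding to the class of this cycle under
   the transfer isomorphism H_1(W_F, X_* ) = T(F). *)
Definition torus_LLC (rec : set L -> gal -> L) F M (C : fieldType)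
    (a : gal -> 'I_n -> C) (chi : (XX -> L) -> C) :=
  is_character (torus_points F) chi /\
  forall rs c, transversal (weil abs p F) (weil abs p M) rs -> cycle1 F c ->
    chi (transfer_point rec M rs c) =
      \prod_(e <- c) \prod_(k < n) a e.1 k ^ (e.2 0 k).

End Tori.

(* w : e_j |-> e_(w j) on Z^n = X^*(S) = X_*(hat S) *)
Definition weyl_mx n (w : 'S_n) : 'M[int]_n :=
  \matrix_(i, j) (i == w j)%:R.

Definition weyl_act (L : fieldType) n (w : 'S_n) (t : 'cV[int]_n -> L) :
  'cV[int]_n -> L := fun l => t (weyl_mx w^-1%g *m l).

Section LGroup.
Variables (C : fieldType) (n : nat).

Definition pinJ : 'M[C]_n :=
  \matrix_(i, j) (if j == rev_ord i then (-1) ^+ i else 0).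

(* The outer automorphism of GL_n preserving the standard pinning (diagonal
   torus, upper triangular Borel, root vectors E_{i,i+1}). *)
Definition theta (g : 'M[C]_n) : 'M[C]_n :=
  pinJ *m (invmx g)^T *m invmx pinJ.

Lemma pinJ_tr : pinJ^T = (-1) ^+ n.-1 *: pinJ.
Proof.
apply/matrixP=> i j; rewrite !mxE.
have -> : (i == rev_ord j) = (j == rev_ord i).
  by apply/eqP/eqP => ->; rewrite rev_ordK.
case: eqP => [->|_]; last by rewrite mulr0.
rewrite /= -exprD -signr_odd -[RHS]signr_odd; congr (_ ^+ nat_of_bool _).
rewrite subnS oddD; have := ltn_ord i; case: n i => [//|m] i.
by rewrite ltnS /= => le_im; rewrite subSKn oddB.
Qed.

Lemma pinJ_sq : pinJ *m pinJ = (-1) ^+ n.-1 *: 1%:M.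
Proof.
apply/matrixP=> i j; rewrite !mxE (bigD1 (rev_ord i)) //= !mxE eqxx big1 ?addr0.
  rewrite rev_ordK eq_sym; case: eqP => [->|_]; last by rewrite !mulr0.
  rewrite -exprD mulr1; congr (_ ^+ _).
  have := ltn_ord j; case: n j => [//|m] j; rewrite ltnS /= => le_jm.
  by rewrite subSS subnKC.
by move=> k /negPf ne; rewrite mxE ne mul0r.
Qed.

Lemma invmx_uniq (A B : 'M[C]_n) : A *m B = 1%:M -> invmx A = B.
Proof.
by move=> e; have [uA _] := mulmx1_unit e; rewrite -[B](mulKmx uA) e mulmx1.
Qed.

Lemma sqr_sign : (-1) ^+ n.-1 * (-1) ^+ n.-1 = 1 :> C.
Proof. by rewrite -exprD addnn -mul2n exprM sqrrN expr1n expr1n. Qed.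

Lemma pinJ_inv : invmx pinJ = (-1) ^+ n.-1 *: pinJ.
Proof.
by apply: invmx_uniq; rewrite -scalemxAr pinJ_sq scalerA sqr_sign scale1r.
Qed.

Lemma pinJ_unit : pinJ \in unitmx.
Proof.
have u : pinJ *m ((-1) ^+ n.-1 *: pinJ) = 1%:M.
  by rewrite -scalemxAr pinJ_sq scalerA sqr_sign scale1r.
by have [] := mulmx1_unit u.
Qed.

Lemma theta_unit g : (theta g \in unitmx) = (g \in unitmx).
Proof.
by rewrite /theta !unitmx_mul unitmx_inv pinJ_unit unitmx_tr unitmx_inv andbT.
Qed.

Lemma thetaM g h : g \in unitmx -> h \in unitmx ->
  theta (g *m h) = theta g *m theta h.
Proof.
move=> ug uh; rewrite /theta (@invmx_uniq _ (invmx h *m invmx g)).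
  by rewrite trmx_mul !mulmxA mulmxKV ?pinJ_unit.
by rewrite !mulmxA mulmxK // mulmxV.
Qed.

Lemma theta1 : theta 1%:M = 1%:M.
Proof. by rewrite /theta invmx1 trmx1 mulmx1 mulmxV // pinJ_unit. Qed.

Lemma thetaK g : g \in unitmx -> theta (theta g) = g.
Proof.
move=> ug; rewrite {1}/theta (@invmx_uniq _ (pinJ *m g^T *m invmx pinJ)).
  have trJ : (invmx pinJ)^T = pinJ.
    by rewrite pinJ_inv linearZ /= pinJ_tr scalerA sqr_sign scale1r.
  rewrite !trmx_mul trmxK trJ pinJ_tr pinJ_inv.
  rewrite -!(scalemxAl, scalemxAr) !scalerA sqr_sign scale1r.
  rewrite !mulmxA pinJ_sq -mulmxA pinJ_sq.
  by rewrite -scalemxAr -!scalemxAl scalerA sqr_sign scale1r mulmx1 mul1mx.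
by rewrite /theta !mulmxA mulmxKV ?pinJ_unit // -(mulmxA pinJ) -trmx_mul
  mulmxV // trmx1 mulmx1 mulmxV ?pinJ_unit.
Qed.

(* ^L G = GL_n(C) ><| Gal(E/K), the group Gal(E/K) = {1, tau} being bool
   with tau = true. *)
Record LG := MkLG {
  lg_mx : 'M[C]_n; lg_gal : bool; lg_unit : lg_mx \in unitmx }.

Lemma LG_eq (x y : LG) : lg_mx x = lg_mx y -> lg_gal x = lg_gal y -> x = y.
Proof.
case: x y => [g a ug] [h b uh] /= eg ea; subst h b.
by congr MkLG; exact: bool_irrelevance.
Qed.

Definition twist (a : bool) (g : 'M[C]_n) := if a then theta g else g.

Lemma twist_unit a g : (twist a g \in unitmx) = (g \in unitmx).
Proof. by case: a; rewrite /= ?theta_unit. Qed.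

Definition lg_one := @MkLG 1%:M false (unitmx1 _ _).

Fact lg_mul_unit (x y : LG) :
  lg_mx x *m twist (lg_gal x) (lg_mx y) \in unitmx.
Proof. by rewrite unitmx_mul twist_unit !lg_unit. Qed.
Definition lg_mul (x y : LG) :=
  @MkLG (lg_mx x *m twist (lg_gal x) (lg_mx y)) (lg_gal x (+) lg_gal y)
        (lg_mul_unit x y).

Fact lg_inv_unit (x : LG) : twist (lg_gal x) (invmx (lg_mx x)) \in unitmx.
Proof. by rewrite twist_unit unitmx_inv lg_unit. Qed.
Definition lg_inv (x : LG) :=
  @MkLG (twist (lg_gal x) (invmx (lg_mx x))) (lg_gal x) (lg_inv_unit x).

Fact lg_mulA : associative lg_mul.
Proof.
move=> x y z; apply: LG_eq => /=; last exact: addbA.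
have := lg_unit x; have := lg_unit y; have := lg_unit z.
case: (lg_gal x); case: (lg_gal y) => /= uz uy ux; last 2 first.
- by rewrite mulmxA.
- by rewrite mulmxA.
- by rewrite [theta (_ *m theta _)]thetaM ?theta_unit // thetaK // mulmxA.
- by rewrite [theta (_ *m lg_mx z)]thetaM // mulmxA.
Qed.
Fact lg_mul1 : left_id lg_one lg_mul.
Proof. by move=> x; apply: LG_eq; rewrite /= ?mul1mx. Qed.
Fact lg_mulr1 : right_id lg_one lg_mul.
Proof.
move=> x; apply: LG_eq; rewrite /= ?addbF //.
by case: (lg_gal x); rewrite /= ?theta1 mulmx1.
Qed.
Fact lg_mulV : left_inverse lg_one lg_inv lg_mul.
Proof.
move=> x; apply: LG_eq; rewrite /= ?addbb //; have ux := lg_unit x.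
by case: (lg_gal x); rewrite /= -?thetaM ?unitmx_inv ?mulVmx ?theta1.
Qed.
Fact lg_mulrV : right_inverse lg_one lg_inv lg_mul.
Proof.
move=> x; apply: LG_eq; rewrite /= ?addbb //; have ux := lg_unit x.
by case: (lg_gal x); rewrite /= ?thetaK ?unitmx_inv ?mulmxV.
Qed.

HB.instance Definition _ := gen_eqMixin LG.
HB.instance Definition _ := gen_choiceMixin LG.
HB.instance Definition _ := isGroup.Build LG
  lg_mulA lg_mul1 lg_mulr1 lg_mulV lg_mulrV.

Definition lg_tau : LG := @MkLG 1%:M true (unitmx1 _ _).

Definition Ghat : set LG := [set x | lg_gal x = false].

Definition Shat : set LG := [set x | Ghat x /\ is_diag_mx (lg_mx x)].

Definition Shat_tau : set LG := [set x | Shat x /\ commute x lg_tau].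

Definition centralizer_hat (A : set LG) : set LG :=
  [set g | Ghat g /\ forall x, A x -> commute g x].

Definition center_LG : set LG := [set x | forall y : LG, commute x y].

(* x normalizes hat S, and acts on it by conjugation as w *)
Definition weyl_image (x : LG) (w : 'S_n) :=
  Ghat x /\ forall d : 'rV[C]_n,
    lg_mx x *m diag_mx d *m invmx (lg_mx x) = diag_mx (\row_i d 0 (w^-1%g i)).

(* The faithful representation (g, 1) |-> diag(g, theta g), tau |-> swap. *)
Definition lg_rep (x : LG) : 'M[C]_(n + n) :=
  if lg_gal x then block_mx 0 (lg_mx x) (theta (lg_mx x)) 0
  else block_mx (lg_mx x) 0 0 (theta (lg_mx x)).

Definition lg_semisimple (x : LG) := diagonalizable (lg_rep x).

End LGroup.

Section Unitary.
Variables (R : realType) (L : closedFieldType) (abs : L -> R) (p n : nat).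
Local Notation gal := (fieldAut L).
Implicit Types (K E M : set L) (H : 'M[L]_n).

(* H is the matrix of a Hermitian form on V = E^n (relative to the involution
   tau of E), the standard basis of E^n being a Witt basis.  The form has
   maximal Witt index, so U(V) is quasi-split; conversely every V with U(V)
   quasi-split has such a basis. *)
Definition witt_gram E (tau : gal) H :=
  [/\ forall i j, E (H i j),
      forall i j, (H i j != 0) = (j == rev_ord i)
    & forall i j, tau (H i j) = H j i].

(* The action of Gal(L/K) on U(V)(L) = GL_n(L), for the K-structure given by
   U(V)(K) = { g in GL_n(E) | g H tau(g)^T = H }. *)
Definition unitary_act E H (s : gal) (g : 'M[L]_n) : 'M[L]_n :=
  if `[< fixes E s >] then map_mx s g
  else H *m invmx (map_mx s g)^T *m invmx H.

(* In a Witt basis the diagonal matrices of U(V) whose middle entry is 1, if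
   there is one, contain a maximal K-split torus; its centralizer S is the
   diagonal torus, and l in Z^n = X^*(S) is the character
   diag(d) |-> \prod_i d_i ^ l_i.  The Galois action on X^*(S) is
   (s l)(s d) = s (l d). *)
Definition diag_char (d : 'rV[L]_n) (l : 'cV[int]_n) : L :=
  \prod_(i < n) d 0 i ^ (l i 0).

Definition XS_action K E H (rhoS : gal -> 'M[int]_n) :=
  forall s, weil abs p K s -> forall d d' : 'rV[L]_n,
    (forall i, d 0 i != 0) ->
    diag_mx d' = unitary_act E H s (diag_mx d) ->
    forall l, diag_char d' (rhoS s *m l) = s (diag_char d l).

(* T: inertia acts on X^*(T) = X^*(S) as on X^*(S), and Fr by omega *)
Definition XT_action K (rhoS rhoT : gal -> 'M[int]_n) (Fr : gal)
    (omega : 'S_n) :=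
  [/\ forall s s', weil abs p K s -> weil abs p K s' ->
        rhoT (s * s')%g = rhoT s *m rhoT s',
      forall s, inertia abs K s -> rhoT s = rhoS s
    & rhoT Fr = weyl_mx omega].

Local Notation lg := (LG R[i] n).

Definition langlands_parameter K E (phi : gal -> lg) :=
  [/\ forall s s', weil abs p K s -> weil abs p K s' ->
        phi (s * s')%g = (phi s * phi s')%g,
      forall s, weil abs p K s -> lg_gal (phi s) = ~~ `[< fixes E s >]
    & (* continuity, inertia being open in the Weil group *)
      forall e : R[i], 0 < e -> exists N, [/\ padic_field abs N, K `<=` N
        & forall s, inertia abs K s -> fixes N s ->
            lg_gal (phi s) = false /\
            forall i j, `|lg_mx (phi s) i j - (i == j)%:R| < e]].

Definition tame_parameter K (phi : gal -> lg) :=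
  forall s, wild_inertia abs K s -> phi s = 1%g.

Definition discrete_parameter K (phi : gal -> lg) :=
  exists F : seq lg, forall g,
    centralizer_hat [set phi s | s in weil abs p K] g ->
    exists f c : lg, [/\ f \in F, center_LG c & g = (f * c)%g].

(* tau is a lift of the topological generator of tame inertia *)
Definition regular_parameter (tau : gal) (phi : gal -> lg) :=
  lg_semisimple (phi tau) /\
  exists h : lg, Ghat h /\
    forall g, centralizer_hat [set phi tau] g <-> Shat_tau (h^-1 * g * h)%g.

(* W_T^I: the action of I on the Weyl group is conjugation in Aut(X^*(T)) *)
Definition weyl_inertia_fixed K (rhoT : gal -> 'M[int]_n) : set 'S_n :=
  [set w | forall s, inertia abs K s ->
           weyl_mx w *m rhoT s = rhoT s *m weyl_mx w].

(* chi is the character chi_phi of T(K)^0: chi \o Norm is the restriction to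
   T(K_f)^0 of the character chif of T(K_f) attached to the restriction of phi
   to W_{K_f}, which takes values in hat S ><| Gal(E/K). *)
Definition parameter_character (rhoT : gal -> 'M[int]_n)
    (rec : set L -> gal -> L) K M (phi : gal -> lg)
    (chi : ('cV[int]_n -> L) -> R[i]) :=
  let Kf := max_unramified abs K M in
  is_character (torus_points0 abs p rhoT K) chi /\
  exists chif : ('cV[int]_n -> L) -> R[i],
    torus_LLC abs p rhoT rec Kf M (fun s k => lg_mx (phi s) k k) chif /\
    forall rs t, transversal (weil abs p K) (weil abs p Kf) rs ->
      torus_points0 abs p rhoT Kf t -> chi (torus_norm rhoT rs t) = chif t.

End Unitary.

(* Main.v *)
Require Import Defs.
From HB Require Import structures.
From mathcomp Require Import all_boot all_order all_algebra all_fingroup.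
From mathcomp Require Import all_classical all_reals.
From mathcomp Require Import complex.
From mathcomp Require Import ring.

Set Implicit Arguments.
Unset Strict Implicit.
Unset Printing Implicit Defensive.

Import Order.TTheory GRing.Theory Num.Theory.
Local Open Scope classical_set_scope.
Local Open Scope ring_scope.

(** Write tau for the generator of tame inertia and u := rec_M(tau^2), a unit of
    M fixed by inertia, hence a unit of K_f.  For a cocharacter x the point
    t_x := (x + tau x)(u) of T(K_f) is the image of the 1-cycle tau^2 (x) x under
    the transfer isomorphism, so chi_phi(Norm t_x) is the pairing of x with
    phi(tau^2) = z^2.  Varying x over a basis, an element w of the Weyl group
    fixing chi_phi must fix z^2, i.e. w z = z e with e^2 = 1.  As e is of the form
    s tau(s)^-1, some representative of w in GL_n centralizes z tau, and w = 1 by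
    regularity.

    To see that Norm t_x lies in T(K)^0, connect it to 1 by a line: if v_i are the
    conjugates of u, the functions 1 + (v_i - 1) X are units on the complement in
    the affine line of the zeros of their product h, which lies in O_K[X]; the
    special fibre of that complement is connected since h(0) = 1, and the points
    X = 0 and X = 1 are integral.

    Galois theory over M and K is replaced by the reciprocity map: if y is fixed
    by W_N, then N and N(y) have the same Weil group, so by surjectivity of rec and
    its compatibility with norms N^* = N(y)^*. *)

(** * Subrings and localizations *)

(** The element tau^2 is used because it acts trivially on the lattice: every cocharacter x then
    gives a 1-cycle, and the transfer to M, with representatives 1 and tau, yields x and tau x with
    the same u. The price is that chi_phi only sees z^2, so z and its w-translate are compared up to
    signs. The signs can be absorbed because tau inverts and reverses the diagonal torus: a product
    s_i s_(n-1-i) takes any prescribed symmetric value, with a square root at a middle index.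

    Membership in T(K)^0 asks for a smooth algebra together with its base change, so both rings are
    constructed explicitly. That u is a unit is essential there: it makes h(1) a unit, hence X = 1
    an integral point. It is proved by taking the norm of u down to Q_p, where the value of
    reciprocity on inertia is known.

    Moving w across Norm requires w to commute with the action of the whole Weil group, while the
    hypotheses speak of inertia and Fr; these two are therefore shown to generate it. *)

Record subring (A : comNzRingType) := Subring {
  subring_mem :> A -> Prop;
  subring_mem1 : subring_mem 1;
  subring_memB : forall x y, subring_mem x -> subring_mem y -> subring_mem (x - y);
  subring_memM : forall x y, subring_mem x -> subring_mem y -> subring_mem (x * y) }.

Section SubringType.
Variables (A : comNzRingType) (S : subring A).

Definition subring_pred : pred A := fun x => `[< S x >].

Fact subring_pred_closed : subring_closed subring_pred.
Proof.
split=> [|x y|x y]; rewrite -!topredE /=.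
- exact/asboolP/subring_mem1.
- by move=> /asboolP hx /asboolP hy; apply/asboolP/subring_memB.
- by move=> /asboolP hx /asboolP hy; apply/asboolP/subring_memM.
Qed.
HB.instance Definition _ := GRing.isSubringClosed.Build A subring_pred subring_pred_closed.

(** The Neron condition quantifies over rings as types, so rings of integers and localizations,
    which arise as predicates, are turned into ring types here. *)
Record subring_type := SubringType { subring_val : A; _ : subring_val \in subring_pred }.
HB.instance Definition _ := [isSub for subring_val].
HB.instance Definition _ := [Choice of subring_type by <:].
HB.instance Definition _ := [SubChoice_isSubComNzRing of subring_type by <:].

HB.instance Definition _ :=
  GRing.RMorphism.copy subring_val (\val : subring_type -> A).

Lemma subring_valP (x : subring_type) : S (subring_val x).
Proof. exact/asboolP/(valP x). Qed.

Definition subring_elt (x : A) (hx : S x) : subring_type := SubringType (asboolT hx).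

End SubringType.

Section Localization.
Variables (A : comNzRingType) (F : fieldType) (iota : {rmorphism A -> F}).
Variable h : A.

(** A[1/h] is realized inside a field containing A, so that equality of fractions is equality in F
    and no quotient is formed. *)
Definition loc_mem (x : F) := exists a m, x * iota h ^+ m = iota a.

Fact loc_mem1 : loc_mem 1.
Proof. by exists 1, 0%N; rewrite expr0 mulr1 rmorph1. Qed.

Fact loc_memB x y : loc_mem x -> loc_mem y -> loc_mem (x - y).
Proof.
move=> [a [m e]] [b [k e']]; exists (a * h ^+ k - b * h ^+ m), (m + k)%N.
rewrite rmorphB !rmorphM !rmorphXn -e -e' mulrBl exprD mulrA; congr (_ - _).
by rewrite [iota h ^+ m * _]mulrC mulrA.
Qed.

Fact loc_memM x y : loc_mem x -> loc_mem y -> loc_mem (x * y).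
Proof.
move=> [a [m e]] [b [k e']]; exists (a * b), (m + k)%N.
by rewrite rmorphM -e -e' exprD mulrACA.
Qed.

Definition loc_subring := Subring loc_mem1 loc_memB loc_memM.
Definition loc := subring_type loc_subring.
HB.instance Definition _ := GRing.ComNzRing.on loc.

Lemma loc_of_mem a : loc_mem (iota a).
Proof. by exists a, 0%N; rewrite expr0 mulr1. Qed.

Definition loc_of a : loc := subring_elt (loc_of_mem a : loc_subring _).

Fact loc_of_is_zmod : zmod_morphism loc_of.
Proof. by move=> a b; apply: val_inj; rewrite /= rmorphB. Qed.
Fact loc_of_is_monoid : monoid_morphism loc_of.
Proof. by split=> [|a b]; apply: val_inj; rewrite /= ?rmorph1 // rmorphM. Qed.
HB.instance Definition _ := GRing.isZmodMorphism.Build A loc loc_of loc_of_is_zmod.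
HB.instance Definition _ := GRing.isMonoidMorphism.Build A loc loc_of loc_of_is_monoid.

Hypothesis iota_inj : injective iota.
Hypothesis h_neq0 : iota h != 0.

Lemma loc_inv_mem : loc_mem (iota h)^-1.
Proof. by exists 1, 1%N; rewrite expr1 mulVf // rmorph1. Qed.

Definition loc_inv : loc := subring_elt (loc_inv_mem : loc_subring _).

Lemma loc_ofV : loc_of h * loc_inv = 1.
Proof. by apply: val_inj; rewrite /= divff. Qed.

Lemma loc_frac (x : loc) : exists a m, x = loc_of a * loc_inv ^+ m.
Proof.
have [a [m e]] := subring_valP x; exists a, m; apply: val_inj.
by rewrite rmorphM rmorphXn /= -e exprVn mulfK // expf_neq0.
Qed.

Lemma loc_uniq (D : comNzRingType) (f g : {rmorphism loc -> D}) :
  (forall a, f (loc_of a) = g (loc_of a)) -> f =1 g.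
Proof.
move=> efg x; have [a [m ->]] := loc_frac x; rewrite !rmorphM !rmorphXn efg.
congr (_ * _ ^+ _).
rewrite -[LHS]mul1r -(rmorph1 g) -loc_ofV rmorphM -efg mulrAC -rmorphM.
by rewrite loc_ofV rmorph1 mul1r.
Qed.

(** D may have zero divisors, so well-definedness is settled in A: two fractions for one x give a
    h^m' = a' h^m there by injectivity of [iota], and the powers of e(h) are then cancelled by those
    of v. *)
Lemma loc_lift (D : comNzRingType) (e : {rmorphism A -> D}) v : e h * v = 1 ->
  exists f : {rmorphism loc -> D}, forall a, f (loc_of a) = e a.
Proof.
move=> ev.
have evn k : e h ^+ k * v ^+ k = 1 by rewrite -exprMn ev expr1n.
have wd (x : F) a m a' m' : x * iota h ^+ m = iota a ->
    x * iota h ^+ m' = iota a' -> e a * v ^+ m = e a' * v ^+ m'.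
  move=> xa xa'.
  have /(congr1 e) : a * h ^+ m' = a' * h ^+ m.
    by apply: iota_inj; rewrite !rmorphM !rmorphXn -xa -xa' mulrAC.
  rewrite !rmorphM !rmorphXn => eaa'.
  by rewrite -[e a]mulr1 -(evn m') mulrA eaa' mulrAC -[e a' * _ * _]mulrA evn mulr1.
have /choice [f fP] : forall x : loc, exists y,
    forall a m, val x * iota h ^+ m = iota a -> y = e a * v ^+ m.
  move=> x; have [a [m xa]] := subring_valP x; exists (e a * v ^+ m) => a' m'.
  exact: wd xa.
have fE (x : loc) : exists a m,
    val x * iota h ^+ m = iota a /\ f x = e a * v ^+ m.
  by have [a [m xa]] := subring_valP x; exists a, m; split=> //; apply: fP.
have fz : zmod_morphism f.
  move=> x y; have [a [m [xa ->]]] := fE x; have [b [k [yb ->]]] := fE y.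
  rewrite (fP (x - y) (a * h ^+ k - b * h ^+ m) (m + k)%N).
    rewrite rmorphB !rmorphM !rmorphXn exprD mulrBl; congr (_ - _).
      by rewrite mulrACA evn mulr1.
    by rewrite [v ^+ m * _]mulrC mulrACA evn mulr1.
  have -> : val (x - y) = val x - val y by [].
  rewrite [RHS]rmorphB !(rmorphM iota) !(rmorphXn iota) -xa -yb mulrBl exprD.
  by rewrite mulrA; congr (_ - _); rewrite [iota h ^+ m * _]mulrC mulrA.
have fm : monoid_morphism f.
  split=> [|x y].
    by rewrite (fP 1 1 0%N) ?rmorph1 ?expr0 ?mulr1 // rmorph1.
  have [a [m [xa ->]]] := fE x; have [b [k [yb ->]]] := fE y.
  rewrite (fP (x * y) (a * b) (m + k)%N).
    by rewrite (rmorphM e) exprD mulrACA.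
  have -> : val (x * y) = val x * val y by [].
  by rewrite (rmorphM iota) -xa -yb exprD mulrACA.
pose f1 := GRing.isZmodMorphism.Build _ _ f fz.
pose f2 := GRing.isMonoidMorphism.Build _ _ f fm.
pose fr : {rmorphism loc -> D} := HB.pack f f1 f2.
exists fr => a.
by rewrite [LHS](fP _ a 0%N) ?expr0 ?mulr1.
Qed.

End Localization.

(** * Non-archimedean absolute values *)

Section AbsoluteValue.
Variables (R : realType) (L : closedFieldType) (abs : L -> R) (p : nat).
Hypothesis absP : padic_closure abs p.
Implicit Types (x y : L) (c : R).

Let ge0 := abs_ge0 absP.

Lemma absZ0 : abs 0 = 0. Proof. exact/(abs_eq0 absP). Qed.

Lemma abs_neq0 x : x != 0 -> abs x != 0.
Proof. by apply: contraNneq => /(abs_eq0 absP) ->. Qed.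

Lemma abs_gt0 x : x != 0 -> 0 < abs x.
Proof. by move=> x0; rewrite lt_neqAle eq_sym abs_neq0 // ge0. Qed.

Lemma absZ1 : abs 1 = 1.
Proof.
apply: (mulfI (abs_neq0 (oner_neq0 L))); rewrite -(absM absP) !mulr1 //.
Qed.

Lemma absX x m : abs (x ^+ m) = abs x ^+ m.
Proof. by elim: m => [|m ih]; rewrite ?absZ1 // !exprS (absM absP) ih. Qed.

Lemma absN x : abs (- x) = abs x.
Proof.
apply/eqP; rewrite -(eqrXn2 (n := 2)) // -!absX sqrrN //.
Qed.

Lemma absV x : abs x^-1 = (abs x)^-1.
Proof.
have [->|x0] := eqVneq x 0; first by rewrite invr0 absZ0 invr0.
by apply: (mulfI (abs_neq0 x0)); rewrite -(absM absP) !divff ?abs_neq0 ?absZ1.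
Qed.

Lemma abs_prod (I : Type) (r : seq I) (P : pred I) (F : I -> L) :
  abs (\prod_(i <- r | P i) F i) = \prod_(i <- r | P i) abs (F i).
Proof. by apply: big_morph; [exact: absM absP | exact: absZ1]. Qed.

Lemma absD_le x y c : abs x <= c -> abs y <= c -> abs (x + y) <= c.
Proof.
by move=> hx hy; apply: le_trans (abs_ultra absP x y) _; rewrite ge_max hx.
Qed.

Lemma absB_le x y c : abs x <= c -> abs y <= c -> abs (x - y) <= c.
Proof. by move=> hx hy; apply: absD_le; rewrite ?absN. Qed.

Lemma absD_lt x y c : abs x < c -> abs y < c -> abs (x + y) < c.
Proof.
by move=> hx hy; apply: le_lt_trans (abs_ultra absP x y) _; rewrite gt_max hx.
Qed.

Lemma absB_lt x y c : abs x < c -> abs y < c -> abs (x - y) < c.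
Proof. by move=> hx hy; apply: absD_lt; rewrite ?absN. Qed.

Lemma absBC x y : abs (x - y) = abs (y - x).
Proof. by rewrite -absN opprB. Qed.

Lemma abs_sub_trans x y z c :
  abs (x - y) < c -> abs (y - z) < c -> abs (x - z) < c.
Proof. by move=> h h'; have := absD_lt h h'; rewrite addrA subrK. Qed.

Lemma abs_sum_le (I : Type) (r : seq I) (P : pred I) (F : I -> L) c :
  0 <= c -> (forall i, P i -> abs (F i) <= c) ->
  abs (\sum_(i <- r | P i) F i) <= c.
Proof.
move=> c0 h; elim/big_ind: _ => [|x y|]; [by rewrite absZ0 | | exact: h].
exact: absD_le.
Qed.

Lemma abs_sum_lt (I : Type) (r : seq I) (P : pred I) (F : I -> L) c :
  0 < c -> (forall i, P i -> abs (F i) < c) ->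
  abs (\sum_(i <- r | P i) F i) < c.
Proof.
move=> c0 h; elim/big_ind: _ => [|x y|]; [by rewrite absZ0 | | exact: h].
exact: absD_lt.
Qed.

Lemma abs_dom x y : abs (x - y) < abs y -> abs x = abs y.
Proof.
move=> h; apply/le_anti/andP; split.
  by rewrite -[x](subrK y) absD_le // ltW.
rewrite leNgt; apply/negP => h'.
suff : abs y < abs y by rewrite ltxx.
by rewrite -{1}[y](subKr x) absB_lt.
Qed.

Lemma absM_le1 x y : abs x <= 1 -> abs y <= 1 -> abs (x * y) <= 1.
Proof. by move=> hx hy; rewrite (absM absP) mulr_ile1. Qed.

Lemma absM_lt1 x y : abs x <= 1 -> abs y < 1 -> abs (x * y) < 1.
Proof.
move=> hx hy; rewrite (absM absP); apply: le_lt_trans hy.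
by rewrite ler_piMl.
Qed.

Lemma absX_le1 x m : abs x <= 1 -> abs (x ^+ m) <= 1.
Proof. by move=> hx; rewrite absX exprn_ile1. Qed.

Lemma absX_lt1 x m : (0 < m)%N -> (abs (x ^+ m) < 1) = (abs x < 1).
Proof. by move=> m0; rewrite absX expr_lt1. Qed.

Lemma abs_subX x y m : abs x <= 1 -> abs y <= 1 -> abs (x - y) < 1 ->
  abs (x ^+ m - y ^+ m) < 1.
Proof.
move=> hx hy hxy; rewrite subrXX mulrC; apply: absM_lt1 => //.
by apply: abs_sum_le => // i _; rewrite absM_le1 ?absX_le1.
Qed.

Lemma abs_nat_le1 m : abs m%:R <= 1.
Proof.
elim: m => [|m ih]; first by rewrite absZ0.
by rewrite -natr1 absD_le // absZ1.
Qed.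

Hypothesis p_prime : prime p.

Lemma absp_gt0 : 0 < abs p%:R.
Proof. by rewrite (abs_p absP) invr_gt0 ltr0n prime_gt0. Qed.

Lemma absp_lt1 : abs p%:R < 1.
Proof.
by rewrite (abs_p absP) invf_lt1 ?ltr0n ?prime_gt0 // ltr1n prime_gt1.
Qed.

(** By Bezout, 1 is a combination of p and m; if |m| < 1, it would follow that |1| < 1. *)
Lemma abs_coprime m : ~~ (p %| m)%N -> abs m%:R = 1.
Proof.
rewrite -prime_coprime // => /coprimeP [|[u v] /= e]; first exact: prime_gt0.
apply/le_anti; rewrite abs_nat_le1 /= leNgt; apply/negP => hm.
suff : abs 1 < 1 by rewrite absZ1 ltxx.
have -> : 1 = u%:R * p%:R - v%:R * m%:R :> L.
  by rewrite -!natrM -natrB ?e // ltnW // -subn_gt0 e.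
by rewrite absB_lt // absM_lt1 ?abs_nat_le1 ?absp_lt1.
Qed.

Lemma abs_dvdp m : (abs m%:R < 1) = (p %| m)%N.
Proof.
apply/idP/idP => [|/dvdnP [k ->]].
  by apply: contraTT => /abs_coprime ->; rewrite ltxx.
by rewrite natrM absM_lt1 ?abs_nat_le1 ?absp_lt1.
Qed.

Lemma abs_frobD x y : abs x <= 1 -> abs y <= 1 ->
  abs ((x + y) ^+ p - x ^+ p - y ^+ p) < 1.
Proof.
move=> hx hy; have := prime_gt1 p_prime; case: p absp_lt1 p_prime => [|[|k]] //.
move=> hp pr _; rewrite exprDn big_ord_recl big_ord_recr /= !bin0 !mulr1n.
rewrite subn0 /= expr0 mulr1 /bump /= binn subnn expr0 mul1r mulr1n.
set s := \sum_(i < _) _.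
have -> : x ^+ k.+2 + (s + y ^+ k.+2) - x ^+ k.+2 - y ^+ k.+2 = s.
  by rewrite [x ^+ _ + _]addrC !addrK.
apply: abs_sum_lt => // i _; rewrite -mulr_natl mulrC absM_lt1 //.
  by rewrite absM_le1 ?absX_le1.
have : (k.+2 %| 'C(k.+2, i.+1))%N by rewrite prime_dvd_bin //= ltnS ltn_ord.
by move=> /dvdnP [m ->]; rewrite natrM absM_lt1 ?abs_nat_le1.
Qed.

(** Additivity of Frobenius modulo the maximal ideal, applied to y + (x - y), bounds (x - y)^p. *)
Lemma abs_frob_inj x y : abs x <= 1 -> abs y <= 1 ->
  abs (x ^+ p - y ^+ p) < 1 -> abs (x - y) < 1.
Proof.
move=> hx hy h; rewrite -(absX_lt1 _ (prime_gt0 p_prime)).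
have hd : abs (x - y) <= 1 by exact: absB_le.
have := abs_frobD hy hd; rewrite [y + _]addrC subrK => /(absB_lt h).
by rewrite opprB addrC subrK.
Qed.

Lemma abs_frobX_inj x y m : abs x <= 1 -> abs y <= 1 ->
  abs (x ^+ (p ^ m) - y ^+ (p ^ m)) < 1 -> abs (x - y) < 1.
Proof.
move=> hx hy; elim: m => [|m ih]; first by rewrite expn0 !expr1.
by rewrite expnSr !exprM => /abs_frob_inj h; apply/ih/h; rewrite absX_le1.
Qed.

(** If |x| > 1, the leading term would strictly dominate all the others. *)
Lemma abs_root_le1 (P : {poly L}) x : P \is monic ->
  (forall i, abs P`_i <= 1) -> root P x -> abs x <= 1.
Proof.
move=> mP hP /rootP; rewrite horner_coef; have sP := monic_neq0 mP.
rewrite -size_poly_gt0 in sP; move: mP hP; rewrite monicE lead_coefE.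
case: (size P) sP => [//|d] _ /= /eqP e hP; rewrite big_ord_recr /= e mul1r.
move=> /eqP; rewrite addrC addr_eq0 => /eqP xd; rewrite leNgt; apply/negP => x1.
suff : abs (x ^+ d) < abs (x ^+ d) by rewrite ltxx.
rewrite {1}xd absN; apply: abs_sum_lt => [|i _].
  by rewrite absX exprn_gt0 // (lt_trans _ x1).
apply: (@le_lt_trans _ _ (abs (x ^+ i))).
  by rewrite (absM absP) ler_piMl.
by rewrite !absX ltr_eXn2l.
Qed.

Lemma poly_root_exists (P : {poly L}) : (1 < size P)%N -> exists x, root P x.
Proof. by move=> h; apply/closed_rootP; rewrite gtn_eqF. Qed.

(* Otherwise a root of X^a - X^b - 1 would be an integer with 1 in the maximal
   ideal. *)
Lemma abs_powers_eq a b : (forall x, abs x <= 1 -> abs (x ^+ a - x ^+ b) < 1) ->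
  a = b.
Proof.
wlog : a b / (b <= a)%N.
  by move=> wl h; case: (leqP b a) => [/wl|/ltnW/wl <- // x]; [exact|
    rewrite absBC; exact: h].
rewrite leq_eqVlt => /orP [/eqP -> //|ltba] h.
pose Q : {poly L} := 'X^b + 1; pose P := 'X^a - Q.
have sQ : (size Q < (size ('X^a : {poly L})))%N.
  rewrite size_polyXn (leq_ltn_trans (size_polyD _ _)) // size_polyXn size_poly1.
  by rewrite gtn_max ltnS ltba /= ltnS (leq_ltn_trans _ ltba).
have mP : P \is monic by rewrite monicE lead_coefDl ?size_polyN // lead_coefXn.
have sP : size P = a.+1 by rewrite size_polyDl ?size_polyN // size_polyXn.
have [|x /[dup] Px] := @poly_root_exists P.
  by rewrite sP ltnS (leq_ltn_trans _ ltba).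
rewrite /root !hornerE /= subr_eq0 => /eqP ex.
suff : abs 1 < 1 by rewrite absZ1 ltxx.
have := h x; rewrite ex addrAC subrr add0r; apply.
apply: (abs_root_le1 mP) Px => i; rewrite !coefE.
by rewrite !absB_le ?absD_le //; case: (_ == _); rewrite ?absZ0 ?absZ1.
Qed.

(* The roots of P modulo the maximal ideal are the reductions of its roots. *)
Lemma abs_root_count (P : {poly L}) (q : nat) (t : 'I_q -> L) : P \is monic ->
  (forall i, abs (P.[t i]) < 1) ->
  (forall i j, abs (t i - t j) < 1 -> i = j) -> (q < size P)%N.
Proof.
move=> mP hP ht; have [rs eP] := closed_field_poly_normal P.
rewrite (monicP mP) scale1r in eP; rewrite eP size_prod_XsubC ltnS.
have /choice [f fP] : forall i, exists j : 'I_(size rs), abs (t i - rs`_j) < 1.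
  move=> i; apply/not_existsP => h; have := hP i; apply/negP; rewrite -leNgt.
  rewrite eP horner_prod abs_prod big_seq.
  apply: (big_ind (fun c => 1 <= c)) => // [c d c1 d1|x xr].
    by rewrite (le_trans c1) // ler_peMr // (le_trans _ c1).
  rewrite hornerXsubC leNgt; apply/negP => hx.
  have ix : (index x rs < size rs)%N by rewrite index_mem.
  by apply: (h (Ordinal ix)); rewrite /= nth_index.
rewrite -[q]card_ord -[size rs]card_ord; apply: (@leq_card _ _ f) => i j eij.
by apply: ht; apply: abs_sub_trans (fP i) _; rewrite absBC eij.
Qed.

End AbsoluteValue.

(** * The field of p-adic numbers *)

Section PadicNumbers.
Variables (R : realType) (L : closedFieldType) (abs : L -> R) (p : nat).
Hypothesis absP : padic_closure abs p.
Hypothesis p_prime : prime p.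
Implicit Types (x y : L) (c : R) (r : rat).

(** Characteristic 0 comes from the absolute value: |p| = 1/p is nonzero, and integers prime to p
    have absolute value 1. *)
Lemma natr_neq0 m : (0 < m)%N -> m%:R != 0 :> L.
Proof.
move=> m0; have [k hk ->] := pfactor_coprime p_prime m0.
rewrite natrM natrX mulf_neq0 //; last first.
  by rewrite expf_neq0 //; apply/eqP => /(abs_eq0 absP) /eqP;
    rewrite (gt_eqF (absp_gt0 absP p_prime)).
apply/eqP => /(abs_eq0 absP) /eqP; rewrite (abs_coprime absP) ?oner_eq0 //.
by rewrite -prime_coprime.
Qed.

Lemma intr_neq0 (m : int) : m != 0 -> m%:~R != 0 :> L.
Proof.
case: m => m m0; first by rewrite -pmulrn natr_neq0 // lt0n.
by rewrite NegzE mulrNz oppr_eq0 -pmulrn natr_neq0.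
Qed.

Lemma ratr_frac (a b : int) : b != 0 ->
  ratr (a%:~R / b%:~R) = a%:~R / b%:~R :> L.
Proof.
move=> b0; set r : rat := _ / _; rewrite /ratr.
have dr0 : (denq r)%:~R != 0 :> L by rewrite intr_neq0 // denq_neq0.
apply/eqP; rewrite eqr_div ?intr_neq0 //; apply/eqP; rewrite -!intrM; congr _%:~R.
apply: (@intr_inj rat); rewrite !intrM numqE mulrAC /r divfK ?intr_eq0 //.
Qed.

Lemma rat_frac r : r = (numq r)%:~R / (denq r)%:~R.
Proof. by rewrite divq_num_den. Qed.

Lemma ratrB_L r r' : ratr (r - r') = ratr r - ratr r' :> L.
Proof.
have d0 := intr_neq0 (denq_neq0 r); have d0' := intr_neq0 (denq_neq0 r').
have q0 : (denq r)%:~R != 0 :> rat by rewrite intr_eq0 denq_neq0.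
have q0' : (denq r')%:~R != 0 :> rat by rewrite intr_eq0 denq_neq0.
rewrite {1}[r]rat_frac {1}[r']rat_frac -mulNr addf_div //.
rewrite -mulrNz -!intrM -intrD ratr_frac ?mulf_neq0 ?denq_neq0 //.
by rewrite /ratr intrD !intrM mulrNz -mulNr addf_div.
Qed.

Lemma ratr0_L : ratr 0 = 0 :> L.
Proof. exact: (ratr_int L 0). Qed.

Lemma ratrMV_L r r' : ratr (r / r') = ratr r / ratr r' :> L.
Proof.
have d0 := intr_neq0 (denq_neq0 r); have d0' := intr_neq0 (denq_neq0 r').
have [->|n0] := eqVneq r' 0; first by rewrite ratr0_L !invr0 !mulr0 ratr0_L.
rewrite {1}[r]rat_frac {1}[r']rat_frac invf_div mulf_div -!intrM.
by rewrite ratr_frac ?mulf_neq0 ?denq_neq0 ?numq_eq0 // !intrM /ratr invf_div mulf_div.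
Qed.

Lemma Qp_ratr r : Qp abs (ratr r).
Proof. by move=> e e0; exists r; rewrite subrr (absZ0 absP). Qed.

Lemma Qp_nat m : Qp abs m%:R.
Proof.
have := Qp_ratr (m%:~R / (Posz 1)%:~R).
by rewrite ratr_frac // divr1 -pmulrn.
Qed.

Lemma QpB x y : Qp abs x -> Qp abs y -> Qp abs (x - y).
Proof.
move=> hx hy e e0; have [r hr] := hx _ e0; have [r' hr'] := hy _ e0.
exists (r - r'); rewrite ratrB_L [X in abs X](_ : _ = x - ratr r - (y - ratr r')).
  exact: (absB_lt absP).
by ring.
Qed.

Lemma QpM x y : Qp abs x -> Qp abs y -> Qp abs (x * y).
Proof.
move=> hx hy e e0; have ge0 := abs_ge0 absP.
have ax0 z : 0 < 1 + abs z by rewrite ltr_wpDr.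
(* The bound 1 gives |r'| <= 1 + |y|, the factor met by the precision chosen for x below; the other
   bound handles x (y - r'). *)
have [r' hr'] := hy (Num.min 1 (e / (1 + abs x))) ltac:(by rewrite lt_min ltr01 divr_gt0).
have [r hr] := hx _ (divr_gt0 e0 (ax0 y)).
exists (r / r'^-1); rewrite ratrMV_L.
have -> : ratr r'^-1 = (ratr r')^-1 :> L.
  by have := ratrMV_L 1 r'; rewrite !mul1r (ratr_int L 1) mul1r.
move: hr'; rewrite invrK lt_min => /andP [h1 h2].
have -> : x * y - ratr r * ratr r' = x * (y - ratr r') + ratr r' * (x - ratr r).
  by rewrite !mulrBr addrA [ratr r' * x]mulrC subrK [ratr r' * _]mulrC.
have ar' : abs (ratr r') <= 1 + abs y.
  rewrite -[ratr r'](subKr y) (absB_le absP) ?lerDr // ler_wpDr // ltW //.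
apply: (absD_lt absP); rewrite (absM absP).
  apply: le_lt_trans (_ : (1 + abs x) * abs (y - ratr r') < e).
    by rewrite ler_wpM2r // lerDr.
  by rewrite mulrC -ltr_pdivlMr.
apply: le_lt_trans (_ : (1 + abs y) * abs (x - ratr r) < e).
  by rewrite ler_wpM2r.
by rewrite mulrC -ltr_pdivlMr.
Qed.

Lemma QpV x : Qp abs x -> Qp abs x^-1.
Proof.
have [->|x0] := eqVneq x 0; first by rewrite invr0.
move=> hx e e0; have ax0 := abs_gt0 absP x0.
(* The first bound forces |r| = |x|; the second then controls |r - x| / |x|^2, the distance between
   the inverses. *)
have [|r] := hx (Num.min (abs x) (e * (abs x * abs x))).
  by rewrite lt_min ax0 !mulr_gt0.
rewrite lt_min => /andP [h1 h2].
have er : abs (ratr r) = abs x by apply: (abs_dom absP); rewrite (absBC absP).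
have r0 : ratr r != 0 :> L.
  by apply/eqP => h; rewrite h (absZ0 absP) in er; rewrite -er ltxx in ax0.
exists r^-1; have -> : ratr r^-1 = (ratr r)^-1 :> L.
  by have := ratrMV_L 1 r; rewrite !mul1r (ratr_int L 1) mul1r.
have -> : x^-1 - (ratr r)^-1 = (ratr r - x) / (x * ratr r).
  by field; rewrite x0 r0.
by rewrite (absM absP) (absV absP) (absM absP) er ltr_pdivrMr ?mulr_gt0 // (absBC absP).
Qed.

Lemma Qp_subfield : is_subfield (Qp abs).
Proof.
split=> [|x y hx hy]; first exact: (Qp_nat 1).
by split; [exact: QpB | apply/QpM/QpV].
Qed.

Lemma Qp_padic : padic_field abs (Qp abs).
Proof.
split=> //; first exact: Qp_subfield.
exists [:: 1]; split=> [y|x hx]; first by rewrite inE => /eqP ->; exact: (Qp_nat 1).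
by exists (fun=> x); split=> //; rewrite big_ord_recl big_ord0 addr0 mulr1.
Qed.

Lemma abs_absz (m : int) : abs m%:~R = abs `|m|%:R.
Proof. by case: m => m //; rewrite NegzE mulrNz (absN absP) -pmulrn abszN. Qed.

Lemma rat_integral r : abs (ratr r) <= 1 -> ~~ (p %| `|denq r|)%N.
Proof.
apply: contraL => pd; rewrite -ltNge.
have pn : ~~ (p %| `|numq r|)%N.
  rewrite -prime_coprime //; have := coprime_num_den r.
  by rewrite coprime_sym; apply: coprime_dvdl.
rewrite /ratr (absM absP) (absV absP) !abs_absz (abs_coprime absP) // mul1r invf_gt1.
  by rewrite (abs_dvdp absP).
by rewrite (abs_gt0 absP) // natr_neq0 // absz_gt0 denq_neq0.
Qed.

Lemma Qp_residue x : Qp abs x -> abs x <= 1 ->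
  exists m, (m < p)%N /\ abs (x - m%:R) < 1.
Proof.
move=> hx x1; have [r hr] := hx 1 ltr01.
have r1 : abs (ratr r) <= 1.
  by rewrite -[ratr r](subKr x) (absB_le absP) // ltW.
have cd : coprimez (denq r) p.
  by rewrite coprimezE /= coprime_sym prime_coprime // rat_integral.
have [[u v] /= uv] := coprimezP _ _ cd.
(* u inverts the denominator of r modulo p, so m is the residue of r. *)
pose m := ((numq r * u) %% p)%Z.
have p0 : p%:Z != 0 by rewrite -lt0n prime_gt0.
have m0 : 0 <= m by rewrite modz_ge0.
exists `|m|%N; split.
  by rewrite -ltz_nat gez0_abs // ltz_pmod // ltz_nat prime_gt0.
apply: (abs_sub_trans absP hr).
have d0 : (denq r)%:~R != 0 :> L by rewrite intr_neq0 // denq_neq0.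
have ad : abs (denq r)%:~R = 1 by rewrite abs_absz (abs_coprime absP) // rat_integral.
rewrite -[abs _]mulr1 -{1}ad -(absM absP) mulrBl /ratr divfK // pmulrn gez0_abs //.
rewrite -intrM -intrB abs_absz (abs_dvdp absP) //.
rewrite -(@dvdzE p) /m; apply/dvdzP.
exists (((numq r * u) %/ p)%Z * denq r + numq r * v).
have := divz_eq (numq r * u) p; set a := (_ %/ _)%Z; set b := (_ %% _)%Z => e.
transitivity (numq r * (u * denq r + v * p) - b * denq r).
  by rewrite uv mulr1.
by rewrite mulrDr mulrA e; ring.
Qed.

(** Evaluating [rec_frob] takes an explicit uniformizer and residue cardinality; they are exhibited
    for Q_p, to which [rec M (tau * tau)] is brought by the norm. *)
Lemma Qp_uniformizer : uniformizer abs (Qp abs) p%:R.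
Proof.
split; [exact: Qp_nat | exact/natr_neq0/prime_gt0 | exact: absp_lt1 |].
move=> x hx x1; have p0 := absp_gt0 absP p_prime.
have [r hr] := hx _ p0.
have r1 : abs (ratr r) < 1.
  rewrite -[ratr r](subKr x) (absB_lt absP) // (lt_trans hr) //.
  exact: absp_lt1.
rewrite -[x](subrK (ratr r)) (absD_le absP) //; first exact: ltW.
have ad : abs (denq r)%:~R = 1.
  by rewrite abs_absz (abs_coprime absP) // rat_integral // ltW.
have en : abs (ratr r) = abs `|numq r|%:R.
  by rewrite /ratr (absM absP) (absV absP) ad invr1 mulr1 abs_absz.
move: r1; rewrite en (abs_dvdp absP) // => /dvdnP [k ->].
by rewrite natrM (absM absP) ler_piMl ?abs_ge0 // ?(abs_nat_le1 absP) // ltW.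
Qed.

Lemma Qp_residue_card : residue_card abs (Qp abs) p.
Proof.
exists [tuple i%:R | i < p]; split=> [i|x [hx x1]].
  by rewrite tnth_mktuple; split; [exact: Qp_nat | exact: (abs_nat_le1 absP)].
have [m [mp hm]] := Qp_residue hx x1; exists (Ordinal mp).
split=> [|i]; rewrite tnth_mktuple // => hi; apply/val_inj => /=.
have : abs (m%:R - i%:R) < 1.
  by apply: (abs_sub_trans absP) hi; rewrite (absBC absP).
rewrite !pmulrn -intrB abs_absz (abs_dvdp absP) //.
have := ltn_ord i; set j := nat_of_ord i => jp.
rewrite -(@dvdzE p) -eqz_mod_dvd => /eqP; rewrite !modz_nat => -[].
by rewrite !modn_small.
Qed.

End PadicNumbers.

(** * Adjunction of an element *)

Section AutMorphism.
Variables (L : fieldType) (s : fieldAut L).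

Fact aut_fun_zmod : zmod_morphism s.
Proof.
move=> x y; rewrite (aut_funD s); congr (_ + _); apply/eqP.
rewrite -addr_eq0 -(aut_funD s) addNr; apply/eqP.
by apply: (addrI (s 0)); rewrite -(aut_funD s) !addr0.
Qed.
Fact aut_fun_monoid : monoid_morphism s.
Proof. by split; [exact: aut_fun1 | exact: aut_funM]. Qed.
HB.instance Definition _ := GRing.isZmodMorphism.Build L L s aut_fun_zmod.
HB.instance Definition _ := GRing.isMonoidMorphism.Build L L s aut_fun_monoid.

Lemma aut_mulE (t : fieldAut L) x : (s * t)%g x = s (t x). Proof. by []. Qed.

Lemma aut_mulVE x : (s^-1)%g (s x) = x. Proof. exact: aut_funK. Qed.

Lemma aut_mulEV x : s ((s^-1)%g x) = x. Proof. exact: aut_invK. Qed.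

End AutMorphism.

Section Subfields.
Variables (L : closedFieldType) (N : set L).
Hypothesis sN : is_subfield N.

Lemma subfield1 : N 1. Proof. by case: sN. Qed.

Lemma subfieldB x y : N x -> N y -> N (x - y).
Proof. by move=> hx hy; have [_ h] := sN; have [] := h x y hx hy. Qed.

Lemma subfield0 : N 0.
Proof. by rewrite -(subrr 1); apply: subfieldB; exact: subfield1. Qed.

Lemma subfieldN x : N x -> N (- x).
Proof. by move=> hx; rewrite -[- x]add0r; apply: subfieldB hx; exact: subfield0. Qed.

Lemma subfieldD x y : N x -> N y -> N (x + y).
Proof. by move=> hx hy; rewrite -[y]opprK; apply/subfieldB/subfieldN. Qed.

Lemma subfield_div x y : N x -> N y -> N (x / y).
Proof. by move=> hx hy; have [_ h] := sN; have [] := h x y hx hy. Qed.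

Lemma subfieldV x : N x -> N x^-1.
Proof. by move=> hx; rewrite -[x^-1]mul1r; apply: subfield_div hx; exact: subfield1. Qed.

Lemma subfieldM x y : N x -> N y -> N (x * y).
Proof. by move=> hx hy; rewrite -[y]invrK; apply/subfield_div/subfieldV. Qed.

Lemma subfieldX x m : N x -> N (x ^+ m).
Proof.
move=> hx; elim: m => [|m ih]; first by rewrite expr0; exact: subfield1.
by rewrite exprS; apply: subfieldM.
Qed.

Lemma subfield_sum (I : Type) (r : seq I) (P : pred I) (F : I -> L) :
  (forall i, P i -> N (F i)) -> N (\sum_(i <- r | P i) F i).
Proof. by move=> h; apply: big_ind h; [exact: subfield0 | exact: subfieldD]. Qed.

End Subfields.

Section Adjunction.
Variables (R : realType) (L : closedFieldType) (abs : L -> R) (p : nat).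
Hypothesis absP : padic_closure abs p.
Hypothesis p_prime : prime p.
Local Notation Q := (Qp abs).
Implicit Types (N : set L) (bs : seq L) (x y : L).

Let sQ : is_subfield Q := Qp_subfield absP p_prime.

Definition Qspan bs x :=
  exists c : nat -> L, (forall i, Q (c i)) /\ x = \sum_(i < size bs) c i * bs`_i.

Lemma Qspan_mem bs b : b \in bs -> Qspan bs b.
Proof.
move=> hb; exists (fun i => (i == index b bs)%:R); split=> [i|].
  by case: (_ == _); [exact: (subfield1 sQ) | exact: (subfield0 sQ)].
have ib : (index b bs < size bs)%N by rewrite index_mem.
rewrite (bigD1 (Ordinal ib)) //= eqxx mul1r nth_index // big1 ?addr0 // => i ne.
by case: eqP => [e|_]; [case/eqP: ne; apply: val_inj | rewrite mul0r].
Qed.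

Lemma Qspan0 bs : Qspan bs 0.
Proof.
exists (fun=> 0); split=> [_|]; first exact: (subfield0 sQ).
by rewrite big1 // => i; rewrite mul0r.
Qed.

Lemma QspanD bs x y : Qspan bs x -> Qspan bs y -> Qspan bs (x + y).
Proof.
move=> [c [hc ->]] [d [hd ->]]; exists (fun i => c i + d i).
split=> [i|]; first exact: (subfieldD sQ).
by rewrite -big_split; apply: eq_bigr => i _; rewrite mulrDl.
Qed.

Lemma QspanZ bs q x : Q q -> Qspan bs x -> Qspan bs (q * x).
Proof.
move=> hq [c [hc ->]]; exists (fun i => q * c i); split=> [i|]; first exact: (subfieldM sQ).
by rewrite mulr_sumr; apply: eq_bigr => i _; rewrite mulrA.
Qed.

Lemma Qspan_sum bs (I : Type) (r : seq I) (P : pred I) (F : I -> L) :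
  (forall i, P i -> Qspan bs (F i)) -> Qspan bs (\sum_(i <- r | P i) F i).
Proof. by move=> h; apply: big_ind h; [exact: Qspan0 | exact: QspanD]. Qed.

Definition adjoin N y : set L :=
  [set x | exists P : {poly L}, (forall i, N P`_i) /\ x = P.[y]].

Lemma adjoin_sub N y : is_subfield N -> N `<=` adjoin N y.
Proof.
move=> sN x hx; exists x%:P; rewrite hornerC; split=> // i.
by rewrite coefC; case: ifP => // _; exact: (subfield0 sN).
Qed.

Lemma adjoin_gen N y : is_subfield N -> adjoin N y y.
Proof.
move=> sN; exists 'X; rewrite hornerX; split=> // i; rewrite coefX.
by case: (_ == _); [exact: (subfield1 sN) | exact: (subfield0 sN)].
Qed.

(* The inverse of x is read off a polynomial over Q_p vanishing at x. *)
Lemma adjoin_subfield N y : is_subfield N -> Q `<=` N -> is_subfield (adjoin N y).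
Proof.
move=> sN QN; split; first by apply: adjoin_sub => //; exact: (subfield1 sN).
have adjB u v : adjoin N y u -> adjoin N y v -> adjoin N y (u - v).
  move=> [P [hP ->]] [P' [hP' ->]]; exists (P - P'); rewrite hornerD hornerN.
  by split=> // i; rewrite coefB; exact: (subfieldB sN).
have adjM u v : adjoin N y u -> adjoin N y v -> adjoin N y (u * v).
  move=> [P [hP ->]] [P' [hP' ->]]; exists (P * P'); rewrite hornerM.
  by split=> // i; rewrite coefM; apply: (subfield_sum sN) => // j _; exact: (subfieldM sN).
have adj0 : adjoin N y 0 by apply: adjoin_sub => //; exact: (subfield0 sN).
have adjV u : adjoin N y u -> adjoin N y u^-1.
  move=> hu; have [->|u0] := eqVneq u 0; first by rewrite invr0.
  have adjP (P : {poly L}) : (forall i, Q P`_i) -> adjoin N y P.[u].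
    move=> hP; elim/poly_ind: P hP => [|P c ih] hP; first by rewrite horner0.
    rewrite !hornerE -[c]opprK; apply: (adjB); first apply: (adjM) hu.
      by apply: ih => i; have := hP i.+1; rewrite coefD coefMX coefC /= addr0.
    apply: (adjoin_sub _ sN); apply/QN/(subfieldN sQ) => //.
    by have := hP 0%N; rewrite coefD coefMX coefC /= add0r.
  have [P0 [P0n hP0 rP0]] := Qp_algebraic absP u.
  have [k] := ubnP (size P0); elim: k P0 P0n hP0 rP0 => // k ih P0 P0n hP0.
  elim/poly_ind: P0 P0n hP0 => [|P c _]; first by rewrite eqxx.
  rewrite rootE !hornerE => Pn hP /eqP e sP.
  have hc : Q c by have := hP 0%N; rewrite coefD coefMX coefC /= add0r.
  have hP' i : Q P`_i by have := hP i.+1; rewrite coefD coefMX coefC /= addr0.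
  have [c0|c0] := eqVneq c 0.
    rewrite c0 polyC0 addr0 in Pn; rewrite c0 polyC0 addr0 in sP.
    move/eqP: e; rewrite c0 addr0 mulf_eq0 (negPf u0) orbF => /eqP e.
    have P0 : P != 0 by apply: contraNneq Pn => ->; rewrite mul0r.
    by apply: (ih P) => //; [exact/rootP | rewrite size_mulX in sP].
  have -> : u^-1 = (- c^-1) * P.[u].
    apply: (mulIf u0); rewrite mulVf // -mulrA; move/eqP: e; rewrite addr_eq0 => /eqP ->.
    by rewrite mulrNN mulVf.
  apply: (adjM); last exact: adjP.
  by apply: (adjoin_sub _ sN); apply/QN/(subfieldN sQ) => //; exact: (subfieldV sQ).
by move=> u v hu hv; split; [exact: adjB | apply/adjM/adjV].
Qed.

Lemma Qp_monic x : exists (d : nat) (c : nat -> L),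
  (forall i, Q (c i)) /\ x ^+ d = \sum_(i < d) c i * x ^+ i.
Proof.
have [P [P0 hP /rootP]] := Qp_algebraic absP x; rewrite horner_coef.
have l0 : lead_coef P != 0 by rewrite lead_coef_eq0.
rewrite -size_poly_gt0 in P0; rewrite lead_coefE in l0.
case: (size P) P0 l0 => [//|d] _ /= l0; rewrite big_ord_recr /= => /eqP.
rewrite addrC addr_eq0 => /eqP e.
exists d, (fun i => - (P`_i / P`_d)); split=> [i|].
  by apply: (subfieldN sQ); apply: (subfield_div sQ).
apply: (mulfI l0); rewrite e mulr_sumr -sumrN; apply: eq_bigr => i _.
by rewrite mulrA mulrN mulrCA divff // mulr1 mulNr.
Qed.

Lemma adjoin_padic N y : padic_field abs N -> padic_field abs (adjoin N y).
Proof.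
move=> [sN QN [bs [bN hb]]]; have sA := adjoin_subfield y sN QN.
have NA := adjoin_sub y sN; have yA := adjoin_gen y sN.
split=> //; first by move=> x /QN /NA.
have [d [c [hc yd]]] := Qp_monic y.
(* Products of the generators of N with the powers of y below the degree d of a monic relation over
   Q_p. *)
exists [seq b * y ^+ j | b <- bs, j <- iota 0 d]; split.
  move=> _ /allpairsP [[b j] /= [/bN bb _ ->]].
  by apply: (subfieldM sA); [exact: NA | exact: (subfieldX sA)].
move=> _ [P [hP ->]]; rewrite -/(Qspan _ _) horner_coef.
apply: Qspan_sum => i _; have [e [he ->]] := hb _ (hP i).
rewrite mulr_suml; apply: Qspan_sum => j _; rewrite -mulrA; apply: QspanZ => //.
set b := bs`_j; have bbs : b \in bs by rewrite mem_nth.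
(* Strong induction on the exponent: for i >= d the relation for y^d rewrites y^i through the y^(i -
   d + l) with l < d. *)
have [k] := ubnP i; move: (nat_of_ord i) => {}i; elim: k i => // k ih i.
rewrite ltnS => ik; have [id|di] := ltnP i d.
  by apply: Qspan_mem; apply: allpairs_f => //; rewrite mem_iota.
rewrite -(subnK di) exprD yd !mulr_sumr; apply: Qspan_sum => l _.
rewrite [X in Qspan _ X](_ : _ = c l * (b * y ^+ (i - d + l))).
  apply: QspanZ => //; apply: ih; apply: leq_trans ik.
  by rewrite -{2}(subnK di) ltn_add2l.
by rewrite exprD; ring.
Qed.

End Adjunction.

(** * Weil groups *)

Section WeilGroup.
Variables (R : realType) (L : closedFieldType) (abs : L -> R) (p : nat).
Hypothesis absP : padic_closure abs p.
Hypothesis p_prime : prime p.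
Local Notation gal := (fieldAut L).
Implicit Types (N : set L) (x y : L) (s t : gal).

(* s acts on the residue field as the (a - b)-th power of the Frobenius; unlike
   [frob_pow], the pair (a, b) can be added and cancelled freely. *)
Definition frob_ratio s a b :=
  forall x, abs x <= 1 -> abs (s x ^+ (p ^ b) - x ^+ (p ^ a)) < 1.

Lemma frob_pow_ratio s k : frob_pow abs p s k -> exists a b, frob_ratio s a b.
Proof.
case: k => m h.
  by exists m, 0%N => x x1; rewrite expn0 expr1; exact: h x x1.
by exists 0%N, m.+1 => x x1; rewrite expn0 expr1; exact: h x x1.
Qed.

(** Nothing in [fieldAut] ties s to [abs]; the congruence itself forces integrality, since a
    positive power of s x is congruent to an integral element. *)
Lemma frob_ratio_int s a b x : frob_ratio s a b -> abs x <= 1 -> abs (s x) <= 1.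
Proof.
move=> h x1; have := h x x1; have pb : (0 < p ^ b)%N by rewrite expn_gt0 prime_gt0.
rewrite leNgt => sx; apply/negP => s1; move: sx; apply/negP; rewrite -leNgt.
have xa : abs (x ^+ (p ^ a)) <= 1 by exact: (absX_le1 absP).
have sb : 1 < abs (s x ^+ (p ^ b)) by rewrite (absX absP) exprn_egt1 -?lt0n.
rewrite leNgt; apply/negP => h'.
have : abs (s x ^+ (p ^ b)) <= 1.
  by rewrite -[s x ^+ _](subrK (x ^+ (p ^ a))) (absD_le absP) // ltW.
by rewrite leNgt sb.
Qed.

Lemma frob_ratio_max s a b x : frob_ratio s a b -> abs x < 1 -> abs (s x) < 1.
Proof.
move=> h x1; have pb k : (0 < p ^ k)%N by rewrite expn_gt0 prime_gt0.
rewrite -(absX_lt1 absP _ (pb b)) -[s x ^+ _](subrK (x ^+ (p ^ a))).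
by rewrite (absD_lt absP) ?h // ?(absX_lt1 absP) // ltW.
Qed.

Lemma frob_ratio_gt1 s a b x : frob_ratio s a b -> 1 < abs x -> 1 < abs (s x).
Proof.
move=> h x1; have x0 : x != 0.
  by apply: contraTneq x1 => ->; rewrite (absZ0 absP) -leNgt.
have : abs x^-1 < 1 by rewrite (absV absP) invf_lt1 // (abs_gt0 absP).
move=> /(frob_ratio_max h); rewrite fmorphV (absV absP) invf_lt1 //.
by rewrite (abs_gt0 absP) // fmorph_eq0.
Qed.

Lemma frob_ratio_cancel s a b c : frob_ratio s (a + c) (b + c) -> frob_ratio s a b.
Proof.
move=> h x x1; have sx := frob_ratio_int h x1; have := h x x1.
by rewrite !expnD !exprM => /(abs_frobX_inj absP p_prime); apply; exact: (absX_le1 absP).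
Qed.

Lemma frob_ratioD s a b c : frob_ratio s a b -> frob_ratio s (a + c) (b + c).
Proof.
move=> h x x1; have sx := frob_ratio_int h x1; rewrite !expnD !exprM.
by apply: (abs_subX absP); rewrite ?(absX_le1 absP) //; exact: h.
Qed.

Lemma frob_ratioM s t a b c d : frob_ratio s a b -> frob_ratio t c d ->
  frob_ratio (s * t)%g (a + c) (b + d).
Proof.
move=> hs ht x x1; have tx := frob_ratio_int ht x1.
apply: (abs_sub_trans absP) (_ : abs (t x ^+ (p ^ (a + d)) - _) < 1).
  exact: (frob_ratioD d hs).
by rewrite addnC [(a + c)%N]addnC; exact: (frob_ratioD a ht).
Qed.

Lemma frob_ratioV s a b : frob_ratio s a b -> frob_ratio (s^-1)%g b a.
Proof.
move=> h x x1; rewrite (absBC absP) -{1}[x](aut_mulEV s); apply: (h).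
by rewrite leNgt; apply/negP => /(frob_ratio_gt1 h); rewrite aut_mulEV ltNge x1.
Qed.

Lemma frob_ratio1 : frob_ratio 1%g 0 0.
Proof. by move=> x _; rewrite subrr (absZ0 absP). Qed.

(** Trades the integer exponent for a pair (a, b), so that products and inverses need no discussion
    of signs; cancelling Frobenius powers recovers the integer a - b. *)
Lemma weilP N s : weil abs p N s <-> fixes N s /\ exists a b, frob_ratio s a b.
Proof.
split=> [[fs [k /frob_pow_ratio h]] //|[fs [a [b h]]]]; split=> //.
have [ba|/ltnW ab] := leqP b a.
  exists (Posz (a - b)) => x x1 /=; rewrite -[s x]expr1 -[1%N](expn0 p).
  by move: x x1; apply: (@frob_ratio_cancel _ _ _ b); rewrite subnK.
have : frob_ratio s 0 (b - a).
  by apply: (@frob_ratio_cancel _ _ _ a); rewrite subnK.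
case: (b - a)%N => [|m] h'; first by exists 0.
by exists (Negz m) => x x1; have := h' x x1; rewrite expn0 expr1.
Qed.

Lemma inertiaP N s : inertia abs N s <-> fixes N s /\ frob_ratio s 0 0.
Proof. by split=> -[fs h]; split=> // x x1; exact: h. Qed.

Lemma fixesM N s t : fixes N s -> fixes N t -> fixes N (s * t)%g.
Proof. by move=> hs ht x hx; rewrite aut_mulE ht // hs. Qed.

Lemma fixesV N s : fixes N s -> fixes N (s^-1)%g.
Proof. by move=> hs x hx; rewrite -{1}(hs x hx) aut_mulVE. Qed.

Lemma weil1 N : weil abs p N 1%g.
Proof. by apply/weilP; split=> //; exists 0%N, 0%N; exact: frob_ratio1. Qed.

Lemma weilM N s t : weil abs p N s -> weil abs p N t -> weil abs p N (s * t)%g.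
Proof.
move=> /weilP [fs [a [b hs]]] /weilP [ft [c [d ht]]]; apply/weilP.
by split; [exact: fixesM | exists (a + c)%N, (b + d)%N; exact: frob_ratioM].
Qed.

Lemma weilV N s : weil abs p N s -> weil abs p N (s^-1)%g.
Proof.
move=> /weilP [fs [a [b hs]]]; apply/weilP.
by split; [exact: fixesV | exists b, a; exact: frob_ratioV].
Qed.

Lemma weilX N s m : weil abs p N s -> weil abs p N (s ^+ m)%g.
Proof.
move=> hs; elim: m => [|m ih]; first by rewrite expg0; exact: weil1.
by rewrite expgS; exact: weilM.
Qed.

Lemma weil_sub N N' s : N `<=` N' -> weil abs p N' s -> weil abs p N s.
Proof. by move=> NN' [fs h]; split=> // x /NN'; exact: fs. Qed.

Lemma weil_fixes N N' s : weil abs p N s -> fixes N' s -> weil abs p N' s.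
Proof. by move=> [_ h] fs; split. Qed.

Lemma inertia_weil N s : inertia abs N s -> weil abs p N s.
Proof. by move=> /inertiaP [fs h]; apply/weilP; split=> //; exists 0%N, 0%N. Qed.

Lemma inertiaM N s t : inertia abs N s -> inertia abs N t -> inertia abs N (s * t)%g.
Proof.
move=> /inertiaP [fs hs] /inertiaP [ft ht]; apply/inertiaP.
by split; [exact: fixesM | exact: (frob_ratioM hs ht)].
Qed.

Lemma weil_unit N s x : weil abs p N s -> abs x = 1 -> abs (s x) = 1.
Proof.
move=> /weilP [_ [a [b h]]] x1; apply/le_anti/andP.
split; first by apply: (frob_ratio_int h); rewrite x1.
rewrite leNgt; apply/negP => sx.
have := frob_ratio_max (frob_ratioV h) sx.
by rewrite aut_mulVE x1 ltxx.
Qed.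

Lemma weil_unitE N s x : weil abs p N s -> (abs (s x) < 1) = (abs x < 1).
Proof.
move=> /weilP [_ [a [b h]]]; apply/idP/idP; last exact: frob_ratio_max h.
by move=> /(frob_ratio_max (frob_ratioV h)); rewrite aut_mulVE.
Qed.

(** * Generation of the Weil group by inertia and a Frobenius element *)

Section Generation.
Variables (K : set L) (q : nat) (Fr : gal).
Hypothesis Kq : residue_card abs K q.
Hypothesis Fr_weil : weil abs p K Fr.
Hypothesis Fr_frob : frob_pow abs q Fr 1.

Lemma residue_card_gt1 : is_subfield K -> (1 < q)%N.
Proof.
move=> sK; have [t [_ tP]] := Kq.
have O0 : Oint abs K 0 by split; [exact: subfield0 | rewrite (absZ0 absP)].
have O1 : Oint abs K 1 by split; [exact: subfield1 | rewrite (absZ1 absP)].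
have [i0 [h0 _]] := tP _ O0; have [i1 [h1 _]] := tP _ O1.
case: q t tP i0 h0 i1 h1 => [|[|m]] // t tP i0 h0 i1; first by case: i0 h0.
rewrite !ord1 => h1; have : abs (1 - 0) < 1.
  by apply: (abs_sub_trans absP h1); rewrite (absBC absP) -(ord1 i0).
by rewrite subr0 (absZ1 absP) ltxx.
Qed.

(** With (a, b) taken from the Weil condition on Fr, the powers q p^b and p^a act alike on the
    residue field of L, hence are equal; so q is a power of p. *)
Lemma frobenius_ratio : is_subfield K ->
  exists2 f, q = (p ^ f)%N & (0 < f)%N /\ frob_ratio Fr f 0.
Proof.
move=> sK; have q1 := residue_card_gt1 sK.
have hF x : abs x <= 1 -> abs (Fr x - x ^+ q) < 1.
  by move=> x1; rewrite -[q]expn1; exact: (Fr_frob x1).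
have /weilP [_ [a [b h]]] := Fr_weil.
have eq : (q * p ^ b)%N = (p ^ a)%N.
  apply: (abs_powers_eq absP) => x x1; apply: (abs_sub_trans absP) (h x x1).
  rewrite exprM (absBC absP); apply: (abs_subX absP); rewrite ?(absX_le1 absP) //.
    exact: frob_ratio_int h x1.
  exact: hF.
have ba : (b <= a)%N.
  by rewrite -(leq_exp2l _ _ (prime_gt1 p_prime)) -eq leq_pmull // ltnW.
have eqf : q = (p ^ (a - b))%N.
  apply/eqP; rewrite -(eqn_pmul2r (m := p ^ b)) ?expn_gt0 ?prime_gt0 //.
  by rewrite eq -expnD subnK.
exists (a - b)%N => //; split.
  by case: (a - b)%N eqf q1 => [|//] ->.
by move=> x x1; rewrite expn0 expr1 -eqf; exact: hF.
Qed.

(* x |-> x ^ (p ^ r) is trivial on the residue field of K, which has more than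
   p ^ r elements when p ^ r < q. *)
Lemma frob_ratio_fix f r s : is_subfield K -> q = (p ^ f)%N -> fixes K s ->
  frob_ratio s r 0 -> (r < f)%N -> r = 0%N.
Proof.
move=> sK eq fs hs rf; apply/eqP; case: r hs rf => [//|r] hs rf; exfalso.
have [t [tO tP]] := Kq; pose P : {poly L} := 'X^(p ^ r.+1) - 'X.
have pr1 : (1 < p ^ r.+1)%N by rewrite -{1}[1%N](expn0 p) ltn_exp2l ?prime_gt1.
have sP : size P = (p ^ r.+1).+1.
  by rewrite size_polyDl ?size_polyXn // size_polyN size_polyX.
have mP : P \is monic.
  by rewrite monicE lead_coefDl ?lead_coefXn // size_polyN size_polyX size_polyXn.
have : (q < size P)%N.
  apply: (abs_root_count absP (t := tnth t)) => // [i|i j ij].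
    rewrite !hornerE; have [tK t1] := tO i; rewrite (absBC absP).
    by have := hs _ t1; rewrite expn0 expr1 fs.
  have [_ t1] := tO i; have [k [hk kP]] := tP _ (tO i).
  have <- : k = i by apply: kP; rewrite subrr (absZ0 absP).
  exact: kP.
by rewrite sP ltnS eq leqNgt ltn_exp2l ?prime_gt1 // rf.
Qed.

(** Powers of Fr bring the Frobenius exponent of s into the interval from 0 to f - 1; as s fixes K,
    whose residue field has p^f elements, this remainder is 0. *)
Lemma weil_generation s : is_subfield K -> weil abs p K s ->
  exists i m k, inertia abs K i /\ s = (i * Fr ^+ m * (Fr ^+ k)^-1)%g.
Proof.
move=> sK Ws; have [f eq [f0 hF]] := frobenius_ratio sK.
have hFX m : frob_ratio (Fr ^+ m)%g (f * m) 0.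
  elim: m => [|m ih]; first by rewrite muln0; exact: frob_ratio1.
  by rewrite expgS mulnS; exact: (frob_ratioM hF ih).
have /weilP [fs [a [b hs]]] := Ws.
(* The exponent a - b of s may be negative; multiplying by [Fr ^+ b] adds f b >= b, so the truncated
   subtraction is exact. *)
pose c := (a + f * b - b)%N; pose m := (c %/ f)%N; pose r := (c %% f)%N.
pose i := (s * Fr ^+ b * (Fr ^+ m)^-1)%g.
have Wi : weil abs p K i.
  by apply: weilM; [apply: weilM | apply: weilV] => //; exact: weilX.
have bfb : (b <= a + f * b)%N by rewrite (leq_trans _ (leq_addl _ _)) // leq_pmull.
have hi : frob_ratio i r 0.
  apply: (@frob_ratio_cancel _ _ _ (b + f * m)).
  have -> : (r + (b + f * m) = a + f * b)%N.
    by rewrite addnCA mulnC [(r + _)%N]addnC -divn_eq subnKC.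
  have := frob_ratioM (frob_ratioM hs (hFX b)) (frob_ratioV (hFX m)).
  by rewrite !addn0 add0n.
have r0 : r = 0%N.
  apply: (frob_ratio_fix sK eq _ hi); first by case: Wi.
  by rewrite ltn_mod.
exists i, m, b; split; last by rewrite mulgKV mulgK.
by apply/inertiaP; split; [case: Wi | rewrite -{1}r0].
Qed.

End Generation.

(** * Fixed fields through the reciprocity map *)

Section Reciprocity.
Variables (geom : bool) (rec : set L -> gal -> L).
Hypothesis recP : reciprocity abs p geom rec.

Lemma transversal1 (G : set gal) : G 1%g -> (forall s, G s -> G (s^-1)%g) ->
  (forall s t, G s -> G t -> G (s * t)%g) -> Defs.transversal G G [:: 1%g].
Proof.
move=> G1 GV GM; split=> [r|g Gg]; first by rewrite inE => /eqP ->.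
by exists ord0; split=> [|i _]; rewrite ?ord1 //= invg1 mul1g.
Qed.

Lemma weil_transversal1 N : Defs.transversal (weil abs p N) (weil abs p N) [:: 1%g].
Proof. by apply: transversal1; [exact: weil1 | exact: weilV | exact: weilM]. Qed.

(* N and N(y) have the same Weil group, hence the same image N^* = N(y)^* of
   the reciprocity map. *)
Lemma weil_fixed_field N y : padic_field abs N ->
  (forall s, weil abs p N s -> s y = y) -> N y.
Proof.
move=> pN hy; have [sN QN _] := pN.
have [->|y0] := eqVneq y 0; first exact: subfield0.
have pA := adjoin_padic absP p_prime y pN; have NA := adjoin_sub y sN.
have eW : weil abs p (adjoin N y) = weil abs p N.
  apply/seteqP; split=> s; first exact: weil_sub.
  move=> Ws; apply: weil_fixes (Ws) _ => _ [P [hP ->]].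
  rewrite !horner_coef rmorph_sum; apply: eq_bigr => i _.
  by rewrite rmorphM rmorphXn /= hy //; case: Ws => ->.
have [s [Ws <-]] := rec_surj recP pA (adjoin_gen y sN) y0.
rewrite eW in Ws.
have := rec_norm recP pN pA NA (rs := [:: 1%g]) (s := s).
rewrite eW big_seq1 -[(1%g : gal) _]/(rec (adjoin N y) s) => <- //; last first.
  exact: weil_transversal1.
by have [] := rec_mem recP pN Ws.
Qed.

End Reciprocity.

End WeilGroup.

(** * Transversals *)

Section Transversals.
Variable L : closedFieldType.
Local Notation gal := (fieldAut L).
Implicit Types (G H : set gal) (s t : gal) (rs : seq gal).

Definition subgroup G :=
  [/\ G 1%g, forall s, G s -> G (s^-1)%g & forall s t, G s -> G t -> G (s * t)%g].

(** Uniqueness in a transversal concerns indices, so redundant members must be discarded: r is kept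
    only if no element already kept lies in its coset. *)
Lemma transversal_of_cover G H rs : subgroup H -> (forall r, r \in rs -> G r) ->
  (forall g, G g -> exists2 r, r \in rs & H (r^-1 * g)%g) ->
  exists rs', Defs.transversal G H rs'.
Proof.
move=> [H1 HV HM] rsG cov.
have [rs' [rG rcov rpw]] : exists rs', [/\ forall r, r \in rs' -> G r,
    forall r, r \in rs -> exists2 r', r' \in rs' & H (r'^-1 * r)%g
  & pairwise (fun r r' => ~~ `[< H (r^-1 * r')%g >]) rs'].
  elim: rs rsG {cov} => [|r rs ih] rsG; first by exists [::].
  have [|rs' [rG rcov rpw]] := ih.
    by move=> r' hr'; apply: rsG; rewrite inE hr' orbT.
  have [hr|nr] := pselect (exists2 r', r' \in rs' & H (r'^-1 * r)%g).
    by exists rs'; split=> // r'; rewrite inE => /predU1P [->|/rcov].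
  exists (rcons rs' r); split=> [r'|r'|].
  - rewrite mem_rcons inE => /predU1P [->|/rG //].
    by apply: rsG; rewrite mem_head.
  - rewrite inE => /predU1P [->|/rcov [r2 r2s h]].
      by exists r; rewrite ?mem_rcons ?mem_head // mulVg.
    by exists r2 => //; rewrite mem_rcons inE r2s orbT.
  rewrite pairwise_rcons rpw andbT; apply/allP => r' hr'.
  by apply/negP => /asboolP h; apply: nr; exists r'.
exists rs'; split=> // g Gg.
have [r rrs Hr] := cov g Gg; have [r' rrs' Hr'] := rcov r rrs.
have ir : (index r' rs' < size rs')%N by rewrite index_mem.
have hg : H (r'^-1 * g)%g by rewrite -[g](mulKVg r) mulgA; exact: HM.
exists (Ordinal ir); split=> [|i hi] /=; first by rewrite nth_index.
have sep (i1 i2 : 'I_(size rs')) : (i1 < i2)%N ->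
    H ((nth 1 rs' i1)^-1 * g)%g -> H ((nth 1 rs' i2)^-1 * g)%g -> False.
  move=> lt12 h1 h2; have /(pairwiseP 1%g) := rpw.
  move=> /(_ i1 i2 (ltn_ord i1) (ltn_ord i2) lt12) /asboolP; apply.
  have := HM _ _ h1 (HV _ h2).
  by rewrite invMg invgK mulgA mulgK.
have hg' : H ((nth 1 rs' (Ordinal ir))^-1 * g)%g by rewrite /= nth_index.
by case: (ltngtP i (Ordinal ir)) => [lt|lt|e];
  [case: (sep _ _ lt hi hg') | case: (sep _ _ lt hg' hi) | exact: val_inj].
Qed.

(** Left translation by s permutes the left cosets of H, and f is this permutation read on
    indices. *)
Lemma transversal_shift G H rs s : subgroup G -> subgroup H -> H `<=` G ->
  Defs.transversal G H rs -> G s ->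
  exists f : 'I_(size rs) -> 'I_(size rs), injective f /\
    forall i, H ((nth 1 rs (f i))^-1 * (s * nth 1 rs i))%g.
Proof.
move=> [G1 GV GM] [H1 HV HM] HG [rG rP] Gs.
have rsG (i : 'I_(size rs)) : G (nth 1%g rs i) by apply: rG; rewrite mem_nth.
have /choice [f fP] : forall i : 'I_(size rs), exists j : 'I_(size rs),
    H ((nth 1 rs j)^-1 * (s * nth 1 rs i))%g.
  by move=> i; have [j [hj _]] := rP _ (GM _ _ Gs (rsG i)); exists j.
exists f; split=> // i j eij.
have [k [_ kP]] := rP _ (rsG j).
rewrite -(kP i); first by apply: kP; rewrite mulVg.
have h1 := fP i; have h2 := fP j; rewrite -eij in h2.
have := HM _ _ (HV _ h1) h2.
by rewrite !invMg invgK !mulgA mulgK mulgKV.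
Qed.

End Transversals.

(** * Finite systems of representatives for Weil groups *)

Section FiniteIndex.
Variables (R : realType) (L : closedFieldType) (abs : L -> R) (p : nat).
Hypothesis absP : padic_closure abs p.
Hypothesis p_prime : prime p.
Local Notation gal := (fieldAut L).
Implicit Types (G H : set gal) (s t : gal) (rs : seq gal).

(* An element b of L has finitely many conjugates over Q_p. *)
Lemma finite_restrictions G (bs : seq L) : G 1%g ->
  (forall s, G s -> fixes (Qp abs) s) ->
  exists rs, (forall r, r \in rs -> G r) /\
    forall s, G s -> exists2 r, r \in rs & forall b, b \in bs -> r b = s b.
Proof.
move=> G1 GQ; elim: bs => [|b bs [rs [rG rcov]]].
  exists [:: 1%g]; split=> [r|s _]; first by rewrite inE => /eqP ->.
  by exists 1%g; rewrite ?mem_head.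
have [P [P0 hP rP]] := Qp_algebraic absP b.
have [zs eP] := closed_field_poly_normal P.
have zsP s : G s -> s b \in zs.
  move=> Gs; rewrite -root_prod_XsubC.
  have : root P (s b).
    have := congr1 s (rootP rP); rewrite rmorph0 !horner_coef rmorph_sum => e.
    apply/rootP; rewrite horner_coef -[RHS]e; apply: eq_bigr => i _.
    by rewrite rmorphM rmorphXn /= (GQ s Gs _ (hP i)).
  by rewrite {1}eP rootZ // lead_coef_eq0.
(* [pk (r, z)] is an element of G that agrees with r on [bs] and sends b to z, when there is one;
   the default is 1. *)
have /choice [pk pkP] : forall rz : gal * L, exists g, G g /\
    ((exists s, [/\ G s, forall c, c \in bs -> rz.1 c = s c & s b = rz.2]) ->
      (forall c, c \in bs -> rz.1 c = g c) /\ g b = rz.2).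
  move=> rz; have [[s [Gs h1 h2]]|ne] := pselect (exists s,
    [/\ G s, forall c, c \in bs -> rz.1 c = s c & s b = rz.2]).
    by exists s.
  by exists 1%g; split=> // /ne.
exists [seq pk (r, z) | r <- rs, z <- zs]; split.
  by move=> _ /allpairsP [[r z] [_ _ ->]]; case: (pkP (r, z)).
move=> s Gs; have [r rrs hr] := rcov s Gs.
exists (pk (r, s b)); first by apply: allpairs_f => //; exact: zsP.
have [_ [|h1 h2]] := pkP (r, s b); first by exists s.
by move=> c; rewrite inE => /predU1P [->|cb]; [exact: h2 | rewrite -(h1 c cb) hr].
Qed.

Lemma weil_subgroup N : subgroup (weil abs p N).
Proof. by split; [exact: weil1 | exact: weilV | exact: weilM]. Qed.

(** Modulo H, an element of W_N is determined by its values on a finite family spanning M over Q_p.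
    H stays general so as to serve for both W_M and W_(K_f). *)
Lemma weil_transversal N M H : Qp abs `<=` N -> padic_field abs M -> subgroup H ->
  (forall s, weil abs p N s -> fixes M s -> H s) ->
  exists rs, Defs.transversal (weil abs p N) H rs.
Proof.
move=> QN [_ _ [bs [bM hbs]]] sH NMH.
have [||rs [rW rcov]] := @finite_restrictions (weil abs p N) bs.
- exact: weil1.
- by move=> s [fs _] x /QN; exact: fs.
apply: (transversal_of_cover sH rW) => s Ws; have [r rrs hr] := rcov s Ws.
have Wr := rW r rrs; exists r => //; have Wrs : weil abs p N (r^-1 * s)%g.
  by apply: weilM => //; exact: weilV.
apply: NMH => // _ /hbs [c [cQ ->]]; rewrite rmorph_sum; apply: eq_bigr => i _.
rewrite rmorphM; congr (_ * _); first by case: Wrs => h _; apply/h/QN.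
by rewrite /= -hr ?mem_nth // -{2}[bs`_i](aut_mulVE r).
Qed.

End FiniteIndex.

(** * Polynomials over rings of integers *)

Section PolyMorphisms.

Lemma poly_morph_eq (A D : comNzRingType) (f g : {rmorphism {poly A} -> D}) :
  (forall c, f c%:P = g c%:P) -> f 'X = g 'X -> f =1 g.
Proof.
move=> hc hX; elim/poly_ind => [|P c ih]; first by rewrite !rmorph0.
by rewrite !rmorphD !rmorphM ih hX hc.
Qed.

Lemma poly_eval (A D : comNzRingType) (d : {rmorphism A -> D}) (x : D) :
  exists e : {rmorphism {poly A} -> D}, e 'X = x /\ forall c, e c%:P = d c.
Proof.
exists (horner_eval x \o map_poly d : {rmorphism _ -> _}).
split=> [|c]; first by rewrite /= map_polyX /horner_eval hornerX.
by rewrite /= map_polyC /horner_eval hornerC.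
Qed.

End PolyMorphisms.

Section UnitPowers.
Variable A : comNzRingType.

(* x ^ k when x' is the inverse of x. *)
Definition powz (x x' : A) (k : int) :=
  match k with Posz m => x ^+ m | Negz m => x' ^+ m.+1 end.

Lemma powzE (F : fieldType) (f : {rmorphism A -> F}) x x' k : x * x' = 1 ->
  f (powz x x' k) = f x ^ k.
Proof.
move=> e; case: k => m /=; rewrite rmorphXn //=.
rewrite NegzE -exprnN -exprVn; congr (_ ^+ _).
have := congr1 f e; rewrite rmorphM rmorph1 => e1.
have fx : f x != 0.
  by apply: contra_eq_neq e1 => ->; rewrite mul0r eq_sym oner_eq0.
by apply: (mulfI fx); rewrite e1 divff.
Qed.

Lemma rmorph_powz (D : comNzRingType) (f : {rmorphism A -> D}) x x' k :
  f (powz x x' k) = (match k with Posz m => f x ^+ m | Negz m => f x' ^+ m.+1 end).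
Proof. by case: k => m /=; rewrite rmorphXn. Qed.

End UnitPowers.

Section IntegralRing.
Variables (R : realType) (L : closedFieldType) (abs : L -> R) (p : nat).
Hypothesis absP : padic_closure abs p.
Variable N : set L.
Hypothesis sN : is_subfield N.

Fact Oint1 : Oint abs N 1.
Proof. by split; [exact: subfield1 | rewrite (absZ1 absP)]. Qed.
Fact OintB x y : Oint abs N x -> Oint abs N y -> Oint abs N (x - y).
Proof. by move=> [nx x1] [ny y1]; split; [exact: subfieldB | exact: (absB_le absP)]. Qed.
Fact OintM x y : Oint abs N x -> Oint abs N y -> Oint abs N (x * y).
Proof. by move=> [nx x1] [ny y1]; split; [exact: subfieldM | exact: (absM_le1 absP)]. Qed.

Definition Oring : subring L := Subring Oint1 OintB OintM.
Local Notation Otype := (subring_type Oring).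

(** Structure maps in the Neron condition are functions on all of L, constrained only on the
    integers of N; elsewhere the value is the default 0. *)
Definition Oproj (x : L) : Otype := insubd (0 : Otype) x.

Lemma val_Oproj x : Oint abs N x -> val (Oproj x) = x.
Proof. by move=> h; apply: insubdK; apply/asboolP. Qed.

Lemma OprojK (c : Otype) : Oproj (val c) = c.
Proof. by apply: val_inj; rewrite val_Oproj //; exact: (subring_valP c). Qed.

Lemma Oproj1 : Oproj 1 = 1.
Proof. by apply: val_inj; rewrite val_Oproj //; exact: Oint1. Qed.

Lemma OprojD x y : Oint abs N x -> Oint abs N y -> Oproj (x + y) = Oproj x + Oproj y.
Proof.
move=> hx hy; apply: val_inj; rewrite [RHS]rmorphD /= !val_Oproj //.
rewrite -[y]opprK; apply: OintB => //; rewrite -[- y]add0r; apply: OintB => //.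
by rewrite -(subrr 1); apply: OintB; exact: Oint1.
Qed.

Lemma OprojM x y : Oint abs N x -> Oint abs N y -> Oproj (x * y) = Oproj x * Oproj y.
Proof.
by move=> hx hy; apply: val_inj; rewrite [RHS]rmorphM /= !val_Oproj //; exact: OintM.
Qed.

Lemma Opoly_exists (P : {poly L}) : (forall i, Oint abs N P`_i) ->
  exists P' : {poly Otype}, map_poly val P' = P.
Proof.
move=> hP; exists (\poly_(i < size P) Oproj P`_i); apply/polyP => i.
rewrite coef_map coef_poly /=; case: ltnP => h; first by rewrite val_Oproj.
by rewrite nth_default.
Qed.

Lemma Oalg_morph (D : comNzRingType) (d : L -> D) : Oalg abs N d ->
  exists d' : {rmorphism Otype -> D}, forall c, d' c = d (val c).
Proof.
move=> [d1 dDM]; pose f (c : Otype) := d (val c).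
have fD c c' : f (c + c') = f c + f c'.
  by have [] := dDM (val c) (val c') (subring_valP c) (subring_valP c').
have f0 : f 0 = 0 by apply: (addrI (f 0)); rewrite -fD !addr0.
have fz : zmod_morphism f.
  move=> c c'; apply: (addIr (f c')); rewrite -fD !subrK //.
have fm : monoid_morphism f.
  split=> [|c c']; first exact: d1.
  by have [] := dDM (val c) (val c') (subring_valP c) (subring_valP c').
pose f1 := GRing.isZmodMorphism.Build _ _ f fz.
pose f2 := GRing.isMonoidMorphism.Build _ _ f fm.
by exists (HB.pack f f1 f2 : {rmorphism Otype -> D}).
Qed.

End IntegralRing.

(** * Gauss's lemma modulo the maximal ideal *)

Section GaussLemma.
Variables (R : realType) (L : closedFieldType) (abs : L -> R) (p : nat).
Hypothesis absP : padic_closure abs p.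
Implicit Types P Q : {poly L}.

Lemma least_unit_coef P : (forall i, abs P`_i <= 1) -> ~ (forall i, abs P`_i < 1) ->
  exists i, abs P`_i = 1 /\ forall j, (j < i)%N -> abs P`_j < 1.
Proof.
move=> hP /existsNP [i0 hi0].
have ex : exists i, abs P`_i == 1.
  by exists i0; apply/eqP/le_anti; rewrite hP /= leNgt; exact/negP.
exists (ex_minn ex); case: ex_minnP => i /eqP e imin; split=> // j ji.
rewrite lt_neqAle hP andbT; apply/negP => /imin; by rewrite leqNgt ji.
Qed.

(** At the sum of the least indices where P and Q have unit coefficients, every other contribution
    to the product involves a coefficient of smaller index, hence of absolute value < 1. *)
Lemma abs_gauss P Q : (forall i, abs P`_i <= 1) -> (forall i, abs Q`_i <= 1) ->
  (forall i, abs (P * Q)`_i < 1) ->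
  (forall i, abs P`_i < 1) \/ (forall i, abs Q`_i < 1).
Proof.
move=> hP hQ hPQ; have [hp|np] := pselect (forall i, abs P`_i < 1); first by left.
have [hq|nq] := pselect (forall i, abs Q`_i < 1); first by right.
have [i [ei imin]] := least_unit_coef hP np.
have [j [ej jmin]] := least_unit_coef hQ nq.
have ij : (i < (i + j).+1)%N by rewrite ltnS leq_addr.
have := hPQ (i + j)%N; rewrite coefM (bigD1 (Ordinal ij)) //= addKn.
set s := \sum_(_ < _ | _) _ => h.
have hs : abs s < 1.
  apply: (abs_sum_lt absP) => // k ne; rewrite (absM absP).
  have [ki|ik] := ltnP k i.
    by rewrite -(absM absP) mulrC (absM_lt1 absP) ?imin.
  rewrite -(absM absP) (absM_lt1 absP) // jmin //.
  have {}ik : (i < k)%N.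
    by rewrite ltn_neqAle ik andbT; apply: contraNneq ne => e; apply/eqP/val_inj.
  have := ltn_ord k; rewrite ltnS => kij.
  by rewrite ltn_subLR // ltn_add2r.
suff : abs (P`_i * Q`_j) < 1 by rewrite (absM absP) ei ej mulr1 ltxx.
by rewrite -[_ * _](addrK s) (absB_lt absP).
Qed.

End GaussLemma.

(** * Points of the identity component of the Neron model *)

Lemma frac_cross (A : comNzRingType) (x x' y y' z z' : A) :
  z * y = 1 -> z' * y' = 1 -> x * y = x' * y' -> x * z' = x' * z.
Proof.
move=> zy zy' e; transitivity (x * y * (z * z')).
  by rewrite -[LHS]mulr1 -zy; ring.
by rewrite e -[RHS]mulr1 -zy'; ring.
Qed.

Section NeronSection.
Variables (R : realType) (L : closedFieldType) (abs : L -> R) (p n : nat).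
Hypothesis absP : padic_closure abs p.
Local Notation gal := (fieldAut L).
Variables (rho : gal -> 'M[int]_n) (N : set L).
Hypothesis sN : is_subfield N.
Hypothesis N_fixed : forall x, (forall s, weil abs p N s -> s x = x) -> N x.
Variables (m : nat) (v : 'I_m -> L) (yy : 'I_m -> 'rV[int]_n).
Hypothesis v_unit : forall i, abs (v i) = 1.
(** Galois permutes the pairs (v_i, yy_i), s acting on cocharacters by y |-> y rho(s)^-1; this makes
    l |-> prod v_i^(yy_i l) a rational point. *)
Hypothesis v_perm : forall s, weil abs p N s -> exists f : 'I_m -> 'I_m,
  injective f /\ forall i, s (v i) = v (f i) /\ yy i = yy (f i) *m rho s.

Local Notation O := (subring_type (Oring absP sN)).
Local Notation F := {fraction {poly L}}.

Let U i : {poly L} := 1 + (v i - 1)%:P * 'X.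
Let h : {poly L} := \prod_i U i.
(** The fraction field of L[X] is the common ambient field for O_N[X][1/h] and for its base change
    L[X][1/h]. *)
Let frac : {rmorphism {poly L} -> F} := @tofrac {poly L}.
Let fracO : {rmorphism {poly O} -> F} := frac \o map_poly val.

Lemma unit_factor_eval i x : (U i).[x] = 1 + (v i - 1) * x.
Proof. by rewrite !hornerE. Qed.

Lemma unit_neq0 i : v i != 0.
Proof.
by apply/eqP => e; have := v_unit i; rewrite e (absZ0 absP) => /eqP; rewrite eq_sym oner_eq0.
Qed.

Lemma units_prod_at0 : h.[0] = 1.
Proof. by rewrite horner_prod big1 // => i _; rewrite unit_factor_eval mulr0 addr0. Qed.

Lemma units_prod_at1 : h.[1] = \prod_i v i.
Proof.
rewrite horner_prod; apply: eq_bigr => i _.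
by rewrite unit_factor_eval mulr1 addrC subrK.
Qed.

Lemma abs_units_prod_at1 : abs h.[1] = 1.
Proof. by rewrite units_prod_at1 (abs_prod absP) big1. Qed.

Lemma units_prod_integral i : abs h`_i <= 1.
Proof.
rewrite /h; move: i; elim/big_ind: _ => [i|P Q hP hQ i|j _ i].
- by rewrite coef1; case: (_ == _); rewrite ?(absZ1 absP) ?(absZ0 absP).
- by rewrite coefM (abs_sum_le absP) // => j _; rewrite (absM_le1 absP).
have hv : abs (v j - 1) <= 1 by rewrite (absB_le absP) ?v_unit ?(absZ1 absP).
rewrite coefD coef1 coefCM coefX (absD_le absP) //.
  by case: (_ == _); rewrite ?(absZ1 absP) ?(absZ0 absP).
by case: (_ == _); rewrite ?mulr1 ?mulr0 ?(absZ0 absP).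
Qed.

Lemma map_unit_factor (s : gal) i j : s (v i) = v j -> map_poly s (U i) = U j.
Proof.
by move=> e; rewrite rmorphD rmorphM rmorph1 /= map_polyX map_polyC /= rmorphB rmorph1 /= e.
Qed.

Lemma units_prod_coef i : Oint abs N h`_i.
Proof.
split; last exact: units_prod_integral.
apply: N_fixed => s Ws; have [f [fI fP]] := v_perm Ws.
rewrite -coef_map; suff -> : map_poly s h = h by []; rewrite /h rmorph_prod /=.
rewrite [RHS](reindex_inj fI); apply: eq_bigr => j _.
by apply: map_unit_factor; have [] := fP j.
Qed.

Lemma torus_point0_of_units :
  torus_points0 abs p rho N (fun l => \prod_i v i ^ ((yy i *m l) 0 0)).
Proof.
set t := fun l => _.
have tE s l : weil abs p N s -> s (t l) = t (rho s *m l).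
  move=> Ws; have [f [fI fP]] := v_perm Ws; rewrite /t rmorph_prod /=.
  rewrite [RHS](reindex_inj fI); apply: eq_bigr => i _.
  by have [e1 e2] := fP i; rewrite fmorphXz /= e1 mulmxA -e2.
split.
  split=> [|s Ws l]; last exact: tE.
  split=> [|l l']; first by rewrite /t big1 // => i _; rewrite mulmx0 mxE expr0z.
  rewrite /t -big_split; apply: eq_bigr => i _.
  by rewrite mulmxDr mxE expfzDr ?unit_neq0.
have [hO hOE] := Opoly_exists absP sN units_prod_coef.
have frac_inj : injective frac by move=> P Q /eqP; rewrite tofrac_eq => /eqP.
have val_polyI : injective (map_poly val : {poly O} -> {poly L}).
  by apply: map_inj_poly; [exact: val_inj | exact: rmorph0].
have fracO_inj : injective fracO by move=> P Q /frac_inj /val_polyI.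
have h_neq0 : h != 0.
  apply/eqP => e; have := units_prod_at0; rewrite e horner0 => /eqP.
  by rewrite eq_sym oner_eq0.
have frac_h : frac h != 0 by rewrite tofrac_eq0.
have fracO_h : fracO hO != 0 by rewrite /fracO /= hOE.
pose B : comNzRingType := loc fracO hO.
pose B' : comNzRingType := loc frac h.
pose inB : {rmorphism {poly O} -> B} := loc_of fracO hO.
pose inB' : {rmorphism {poly L} -> B'} := loc_of frac h.
pose hV : B := loc_inv fracO_h.
pose hV' : B' := loc_inv frac_h.
have hVE : inB hO * hV = 1 := loc_ofV fracO_h.
have hVE' : inB' h * hV' = 1 := loc_ofV frac_h.
have fracB (b : B) : exists P k, b = inB P * hV ^+ k := loc_frac fracO_h b.
pose a (x : L) : B := inB (Oproj absP sN x)%:P.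
have aval (c : O) : a (val c) = inB c%:P by rewrite /a OprojK.
have B_eq (D : comNzRingType) (f g : {rmorphism B -> D}) :
    (forall x, Oint abs N x -> f (a x) = g (a x)) -> f (inB 'X) = g (inB 'X) ->
    f =1 g.
  move=> hc hX; apply: (loc_uniq fracO_h); apply: (@poly_morph_eq _ _ (f \o inB) (g \o inB)).
    by move=> c /=; rewrite -aval; apply: hc; exact: (subring_valP c).
  exact: hX.
have B_lift (D : comNzRingType) (e : {rmorphism {poly O} -> D}) w : e hO * w = 1 ->
    exists f : {rmorphism B -> D}, forall P, f (inB P) = e P.
  exact: (loc_lift fracO_inj).
have B'_lift (D : comNzRingType) (e : {rmorphism {poly L} -> D}) w : e h * w = 1 ->
    exists f : {rmorphism B' -> D}, forall P, f (inB' P) = e P.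
  exact: (loc_lift frac_inj).
have [i iE] : exists i : {rmorphism B -> B'}, forall P, i (inB P) = inB' (map_poly val P).
  by apply: (B_lift _ (inB' \o map_poly val) hV'); rewrite /= hOE.
pose j : {rmorphism L -> B'} := inB' \o polyC.
have ev (x : L) : h.[x] != 0 -> exists y : {rmorphism B' -> L},
    forall P, y (inB' P) = P.[x].
  by move=> hx; apply: (B'_lift _ (horner_eval x) (h.[x])^-1); rewrite /horner_eval divff.
have [y0 y0E] : exists y : {rmorphism B' -> L}, forall P, y (inB' P) = P.[0].
  by apply: ev; rewrite units_prod_at0 oner_neq0.
have [y1 y1E] : exists y : {rmorphism B' -> L}, forall P, y (inB' P) = P.[1].
  apply: ev; apply/eqP => e; have := abs_units_prod_at1; rewrite e (absZ0 absP) => /eqP.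
  by rewrite eq_sym oner_eq0.
(* The inverse of [U k], needed for negative exponents: the remaining factors of h, divided by h. *)
pose W k : B' := inB' (\prod_(k' | k' != k) U k') * hV'.
have UW k : inB' (U k) * W k = 1.
  by rewrite /W mulrA -rmorphM -hVE'; congr (inB' _ * _); rewrite /h [RHS](bigD1 k).
pose u (l : 'cV[int]_n) : B' := \prod_k powz (inB' (U k)) (W k) ((yy k *m l) 0 0).
exists B, B', a, i, j, u, y0, y1; split.
- split.
  + split=> [|x y hx hy]; first by rewrite /a Oproj1 rmorph1.
    by rewrite /a OprojD // OprojM // polyCD polyCM rmorphD rmorphM.
  + exists [:: inB 'X; hV] => S Sa Sg SDM b.
    have S1 : S 1 by have := Sa 1 (Oint1 absP sN); rewrite /a Oproj1 rmorph1.
    have SX : S (inB 'X) by apply: Sg; rewrite mem_head.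
    have SV k : S (hV ^+ k).
      elim: k => [//|k ih]; rewrite exprS; case: (SDM hV (hV ^+ k)) => //.
      by apply: Sg; rewrite !inE eqxx orbT.
    have SC (c : O) : S (inB c%:P) by rewrite -aval; apply: Sa; exact: (subring_valP c).
    have SP P : S (inB P).
      elim/poly_ind: P => [|P c ih]; first exact: (SC 0).
      rewrite rmorphD rmorphM.
      by case: (SDM (inB P * inB 'X) (inB c%:P)) => //; case: (SDM (inB P) (inB 'X)).
    by have [P [k ->]] := fracB b; case: (SDM (inB P) (hV ^+ k)).
  + move=> D D' pr d f pr_surj pr_sq dO fd.
    have [d' d'E] := Oalg_morph absP sN dO.
    (* X may be lifted arbitrarily; the lift extends to B as soon as the image of h is
       invertible. *)
    have [x xE] := pr_surj (f (inB 'X)); have [e [eX eC]] := poly_eval d' x.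
    have pe P : pr (e P) = f (inB P).
      apply: (@poly_morph_eq _ _ (pr \o e) (f \o inB)) => [c|] /=.
        by rewrite eC d'E -aval -fd //; exact: (subring_valP c).
      by rewrite eX.
    have [w wE] := pr_surj (f hV).
    have [g gE] : exists g : {rmorphism B -> D}, forall P, g (inB P) = e P.
      pose k := e hO * w - 1.
      have k0 : pr k = 0 by rewrite rmorphB rmorphM rmorph1 pe wE -rmorphM hVE rmorph1 subrr.
      (* k lies in the kernel, whose square is zero, so (1 + k)(1 - k) = 1 turns the approximate
         inverse w into an exact one. *)
      apply: (B_lift _ e (w * (1 - k))).
      rewrite mulrA -[e hO * w](subrK 1) -/k mulrBr mulr1 mulrDl mul1r pr_sq // add0r.
      by rewrite [k + 1]addrC addrK.
    have ga c : Oint abs N c -> g (a c) = d c.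
      by move=> hc; rewrite gE eC d'E val_Oproj.
    exists g; split=> //; apply: (B_eq _ (pr \o g) f) => [c hc|] /=; first by rewrite ga // fd.
    by rewrite gE pe.
(* Modulo pi, B is a polynomial ring over the residue field localized at a nonzero element. It is a
   domain, which Gauss's lemma expresses on coefficients, so its only idempotents are 0 and 1. *)
- move=> pi [Npi pi0 pi1 pimax].
  have Opi : Oint abs N pi by split=> //; exact: ltW.
  pose piO : O := Oproj absP sN pi.
  have piOE : val piO = pi := val_Oproj absP sN Opi.
  have inB_inj P Q : inB P = inB Q -> P = Q.
    by move=> /(congr1 val) /= /fracO_inj.
  have hVX k : inB hO ^+ k * hV ^+ k = 1 by rewrite -exprMn hVE expr1n.
  have clear P k Q l : inB P * hV ^+ k = inB Q * hV ^+ l -> P * hO ^+ l = Q * hO ^+ k.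
    move=> e; apply: inB_inj; rewrite !rmorphM !rmorphXn.
    exact: frac_cross (hVX k) (hVX l) e.
  have divpi (P : {poly O}) : (forall k, abs (val P`_k) < 1) -> exists Q, P = piO%:P * Q.
    move=> hP; have hQ k : Oint abs N (pi^-1 * val P`_k).
      have [NP P1] := subring_valP P`_k; split.
        by apply: (subfieldM sN) => //; exact: (subfieldV sN).
      rewrite (absM absP) (absV absP) mulrC ler_pdivrMr ?(abs_gt0 absP) // mul1r.
      exact: pimax.
    exists (\poly_(k < size P) Oproj absP sN (pi^-1 * val P`_k)).
    apply/polyP => k; apply: val_inj; rewrite coefCM coef_poly /=.
    case: ltnP => hk; last by rewrite nth_default // mulr0.
    rewrite -[RHS]/(val piO * val (Oproj absP sN (pi^-1 * val P`_k))) piOE.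
    by rewrite val_Oproj // mulVKf.
  have hO_0 : ~ (forall k, abs (val hO`_k) < 1).
    move=> hh; have := hh 0%N; rewrite -(coef_map val) /= hOE -horner_coef0 units_prod_at0.
    by rewrite (absZ1 absP) ltxx.
  have gauss (P Q : {poly O}) : (forall k, abs (val (P * Q)`_k) < 1) ->
      (forall k, abs (val P`_k) < 1) \/ (forall k, abs (val Q`_k) < 1).
    have vE (T : {poly O}) k : val T`_k = (map_poly val T)`_k by rewrite coef_map.
    move=> hPQ.
    have [k|k|k|hP|hQ] := @abs_gauss _ _ _ _ absP (map_poly val P) (map_poly val Q).
    - by rewrite -vE; have [] := subring_valP P`_k.
    - by rewrite -vE; have [] := subring_valP Q`_k.
    - by rewrite -rmorphM -vE.
    - by left=> k; rewrite vE.
    - by right=> k; rewrite vE.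
  have hO_X k : ~ (forall l, abs (val (hO ^+ k)`_l) < 1).
    elim: k => [|k ih]; last by rewrite exprS => /gauss [/hO_0|/ih].
    by move/(_ 0%N); rewrite coef1 (absZ1 absP) ltxx.
  have mulpi (Q : {poly O}) k : abs (val (piO%:P * Q)`_k) < 1.
    rewrite coefCM -[val _]/(val piO * val Q`_k) piOE mulrC (absM_lt1 absP) //.
    by have [] := subring_valP Q`_k.
  split=> [b|e [b eb]].
    have [Q [k ->]] := fracB b; rewrite /a mulrA -rmorphM => e1.
    apply: (hO_X k) => l; have := clear 1 0%N (piO%:P * Q) k.
    rewrite rmorph1 expr0 !mul1r mulr1 => /(_ e1) ->; exact: mulpi.
  have [P [k eP]] := fracB e; have [Q [l eQ]] := fracB b.
  (* For e = P / h^k one has e^2 - e = P (P - h^k) / h^(2k); the extra factor h^l clears the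
     denominator of b. *)
  have : (forall r, abs (val (P * (P - hO ^+ k) * hO ^+ l)`_r) < 1).
    have eE : e * e - e = inB (P * (P - hO ^+ k)) * hV ^+ (k + k).
      rewrite eP rmorphM rmorphB rmorphXn exprD; set x := inB P; set y := hV ^+ k.
      have xy := hVX k; set z := inB hO ^+ k in xy *.
      rewrite mulrBr mulrBl mulrACA; congr (_ - _).
      by rewrite [y]lock -mulrA; unlock; rewrite [z * _]mulrA xy mul1r.
    move=> r; rewrite (clear _ (k + k)%N (piO%:P * Q) l).
      by rewrite -mulrA; exact: mulpi.
    by rewrite -eE eb eQ /a mulrA -rmorphM.
  move=> /gauss [/gauss [/divpi [P' eP']|/divpi [P' eP']]|/hO_X //].
    left; exists (inB P' * hV ^+ k); rewrite eP eP' rmorphM mulrA //.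
  right; exists (- (inB P' * hV ^+ k)).
  by rewrite eP -(hVX k) -mulrBl mulrN mulrA -rmorphM -eP' rmorphB rmorphXn -mulNr opprB.
- split=> [x hx|D f g fg]; first by rewrite /a iE map_polyC /= val_Oproj.
  have [e [eX eC]] := poly_eval g (f (inB 'X)).
  have ef P : e (map_poly val P) = f (inB P).
    apply: (@poly_morph_eq _ _ (e \o map_poly val) (f \o inB)) => [c|] /=.
      by rewrite map_polyC eC -aval fg //; exact: (subring_valP c).
    by rewrite map_polyX eX.
  split; last first.
    move=> k k' ki kj; apply: (loc_uniq frac_h) => P.
    apply: (@poly_morph_eq _ _ (k \o inB') (k' \o inB')) => [c|] /=; first exact: kj.
    by have := ki (inB 'X); rewrite /= iE map_polyX.
  have [k kE] : exists k : {rmorphism B' -> D}, forall P, k (inB' P) = e P.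
    by apply: (B'_lift _ e (f hV)); rewrite -hOE ef -rmorphM hVE rmorph1.
  exists k; split=> [|x] /=; last by rewrite kE eC.
  apply: (B_eq _ (k \o i) f) => [x hx|] /=; last by rewrite iE kE ef.
  by rewrite iE kE ef.
- split.
    pose w : {rmorphism B' -> F} := val.
    have wU k z : w (powz (inB' (U k)) (W k) z) = w (inB' (U k)) ^ z by exact: powzE (UW k).
    have wU0 k : w (inB' (U k)) != 0.
      have := congr1 w (UW k); rewrite rmorphM rmorph1 => e.
      by apply: contra_eq_neq e => ->; rewrite mul0r eq_sym oner_eq0.
    split=> [|l l']; apply: val_inj; rewrite -[LHS]/(w _) -[RHS]/(w _).
      by rewrite rmorph1 rmorph_prod big1 // => k _; rewrite wU mulmx0 mxE expr0z.
    rewrite rmorphM !rmorph_prod -big_split; apply: eq_bigr => k _.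
    rewrite [RHS]/= [LHS]wU [w (powz _ _ ((yy k *m l) 0 0))]wU.
    rewrite [w (powz _ _ ((yy k *m l') 0 0))]wU.
    by rewrite mulmxDr mxE (expfzDr _ _ (wU0 k)).
  move=> s Ws S Si Sj l; have [f [fI fP]] := v_perm Ws.
  have SX : S (inB' 'X) = inB' 'X by have := Si (inB 'X); rewrite /= iE map_polyX.
  (* S fixes X and acts as s on constants, so it permutes the factors as s permutes the v_k. *)
  have SU k : S (inB' (U k)) = inB' (U (f k)).
    have [sv _] := fP k.
    have es : s (v k - 1) = v (f k) - 1 by rewrite rmorphB rmorph1 /= sv.
    have UE k' : inB' (U k') = 1 + j (v k' - 1) * inB' 'X.
      by rewrite -(rmorph1 inB') -(rmorphM inB') -(rmorphD inB').
    rewrite !UE (rmorphD S) (rmorph1 S) (rmorphM S) SX.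
    by rewrite [S (j _)]Sj es.
  have SW k : S (W k) = W (f k).
    have e1 := congr1 S (UW k); rewrite rmorphM rmorph1 SU in e1.
    by rewrite -[LHS]mul1r -(UW (f k)) mulrAC e1 mul1r.
  rewrite /u rmorph_prod [RHS](reindex_inj fI); apply: eq_bigr => k _.
  have [_ e2] := fP k; rewrite rmorph_powz SU SW mulmxA -e2; by case: (_ 0 0).
(* An integral x gives an integral point of B when h(x) is a unit, since 1/h then takes an integral
   value. *)
have Oy (y : {rmorphism B' -> L}) x : (forall P, y (inB' P) = P.[x]) -> N x ->
    abs x <= 1 -> abs h.[x] = 1 -> forall b, Oint abs N (y (i b)).
  move=> yE Nx x1 hx b; have [P [k ->]] := fracB b.
  have hPx (Q : {poly O}) : Oint abs N (map_poly val Q).[x].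
    rewrite horner_coef; split.
      apply: (subfield_sum sN) => r _; apply: (subfieldM sN); last exact: subfieldX.
      by rewrite coef_map; have [] := subring_valP Q`_r.
    apply: (abs_sum_le absP) => // r _; rewrite (absM_le1 absP) ?(absX_le1 absP) //.
    by rewrite coef_map; have [] := subring_valP Q`_r.
  have yV : y (i hV) = h.[x]^-1.
    have hx0 : h.[x] != 0.
      by apply/eqP => e; move: hx; rewrite e (absZ0 absP) => /eqP; rewrite eq_sym oner_eq0.
    apply: (mulfI hx0); rewrite divff // -[in LHS]hOE -yE -iE -!rmorphM.
    by rewrite hVE !rmorph1.
  rewrite (rmorphM i) (rmorphM y) (rmorphXn i) (rmorphXn y) iE yE yV.
  have [Nh _] := hPx hO; rewrite hOE in Nh.
  have [NP P1] := hPx P; split.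
    apply: (subfieldM sN) => //; apply: (subfieldX sN); exact: (subfieldV sN).
  by rewrite (absM_le1 absP) // (absX_le1 absP) // (absV absP) hx invr1.
split.
- split=> [x|b]; first by rewrite y0E hornerC.
  apply: (Oy _ 0) => //; [exact: subfield0 | by rewrite (absZ0 absP) |].
  by rewrite units_prod_at0 (absZ1 absP).
- split=> [x|b]; first by rewrite y1E hornerC.
  apply: (Oy _ 1) => //; [exact: subfield1 | by rewrite (absZ1 absP) |].
  exact: abs_units_prod_at1.
- move=> l; rewrite rmorph_prod big1 // => k _.
  by rewrite powzE // y0E unit_factor_eval mulr0 addr0 exp1rz.
- move=> l; rewrite rmorph_prod; apply: eq_bigr => k _.
  by rewrite powzE // y1E unit_factor_eval mulr1 addrC subrK.
Qed.

End NeronSection.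

(** * Norms of points given by units *)

Section NormPoint.
Variables (R : realType) (L : closedFieldType) (abs : L -> R) (p n : nat).
Hypothesis absP : padic_closure abs p.
Hypothesis p_prime : prime p.
Local Notation gal := (fieldAut L).
Variables (rho : gal -> 'M[int]_n) (N N' : set L).
Hypothesis sN : is_subfield N.
Hypothesis N_fixed : forall x, (forall s, weil abs p N s -> s x = x) -> N x.
Hypothesis NN' : N `<=` N'.
Hypothesis rho1 : rho 1%g = 1%:M.
Hypothesis rhoM : forall s t, weil abs p N s -> weil abs p N t ->
  rho (s * t)%g = rho s *m rho t.
Variables (u : L) (y : 'rV[int]_n).
Hypothesis u_unit : abs u = 1.
Hypothesis u_fixed : forall s, weil abs p N' s -> s u = u.
Hypothesis y_fixed : forall s, weil abs p N' s -> y *m rho s = y.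

(** The norm is the point attached to the pairs (r u, y rho(r^-1)). Writing s r_i = r_(f i) g with g
    in W_N', which fixes u and y, shows that s carries the i-th pair to the f(i)-th. *)
Lemma torus_norm_point0 rs :
  Defs.transversal (weil abs p N) (weil abs p N') rs ->
  torus_points0 abs p rho N (torus_norm rho rs (fun l => u ^ ((y *m l) 0 0))).
Proof.
move=> rsP; have rW r : r \in rs -> weil abs p N r by case: rsP => h _; exact: h.
pose r (i : 'I_(size rs)) := nth 1%g rs i.
have rWi i : weil abs p N (r i) by apply: rW; rewrite mem_nth.
have -> : torus_norm rho rs (fun l => u ^ ((y *m l) 0 0)) =
    fun l => \prod_i (r i u) ^ (((y *m rho (r i)^-1%g) *m l) 0 0).
  apply/funext => l; rewrite /torus_norm (big_nth 1%g) big_mkord.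
  by apply: eq_bigr => i _; rewrite fmorphXz mulmxA.
apply: (torus_point0_of_units absP sN N_fixed) => [i|s Ws].
  exact: (weil_unit absP p_prime (rWi i)).
have [f [fI fP]] := transversal_shift (weil_subgroup absP p_prime N)
  (weil_subgroup absP p_prime N') (fun t Wt => weil_sub NN' Wt) rsP Ws.
exists f; split=> // i; set g := ((r (f i))^-1 * (s * r i))%g.
have Wg : weil abs p N' g := fP i.
have WgN : weil abs p N g by exact: (weil_sub NN' Wg).
have sri : (s * r i)%g = (r (f i) * g)%g by rewrite mulKVg.
split; first by rewrite -[LHS]/((s * r i)%g u) sri aut_mulE u_fixed.
have -> : ((r i)^-1 = g^-1 * (r (f i))^-1 * s)%g.
  by rewrite -[in RHS]invMg -sri invMg mulgKV.
have WV t : weil abs p N t -> weil abs p N (t^-1)%g by exact: weilV.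
rewrite !rhoM ?mulmxA; try by [apply: weilM; auto | auto].
rewrite y_fixed //; exact: weilV.
Qed.

End NormPoint.

(** * Regular elements of the dual group *)

Section RegularElements.
Variables (C : closedFieldType) (n : nat).
Local Notation lg := (LG C n).
Local Notation J := (pinJ C n).
Implicit Types (z g : lg) (w : 'S_n) (c d e : 'I_n -> C).

Definition monomial_mx w c : 'M[C]_n := \matrix_(i, j) (if i == w j then c j else 0).
Definition antidiag_mx d : 'M[C]_n := \matrix_(i, j) (if j == rev_ord i then d i else 0).

(** A matrix m commutes with z tau iff m (z J) m^T = z J, that is, iff it preserves a bilinear form
    with antidiagonal matrix; a monomial m over w permutes and rescales the entries of such a
    form. *)
Lemma monomial_conj w c d e : (forall i, w (rev_ord i) = rev_ord (w i)) ->
  (forall i, c i * c (rev_ord i) * d i = e (w i)) ->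
  monomial_mx w c *m antidiag_mx d *m (monomial_mx w c)^T = antidiag_mx e.
Proof.
move=> w_rev cd; apply/matrixP=> a b.
rewrite -[a](permKV w) -[b](permKV w); set i := (w^-1)%g a; set k := (w^-1)%g b.
rewrite mxE (bigD1 k) //= big1 ?addr0 => [|l ne]; last first.
  by rewrite !mxE (inj_eq perm_inj) eq_sym (negPf ne) mulr0.
rewrite [in X in _ * X]mxE [in X in _ * X]mxE eqxx mxE (bigD1 i) //= big1 ?addr0 => [|l ne].
  rewrite !mxE eqxx -w_rev (inj_eq perm_inj).
  case: (eqVneq k (rev_ord i)) => [->|_]; last by rewrite mulr0 mul0r.
  by rewrite -cd mulrAC.
by rewrite !mxE (inj_eq perm_inj) eq_sym (negPf ne) mul0r.
Qed.

Lemma pinJE : J = antidiag_mx (fun i => (-1) ^+ i). Proof. by []. Qed.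

Lemma diag_antidiag (A : 'M[C]_n) d : is_diag_mx A ->
  A *m antidiag_mx d = antidiag_mx (fun i => A i i * d i).
Proof.
move=> /diag_mxP [a ->]; rewrite mul_diag_mx; apply/matrixP=> i j; rewrite !mxE eqxx.
by case: ifP => _; rewrite ?mulr0 // mulr1n.
Qed.

Lemma theta_eqP (A B : 'M[C]_n) : A \in unitmx ->
  (B = theta A) <-> (B *m J *m A^T = J).
Proof.
move=> uA; have uJ := pinJ_unit C n; rewrite /theta trmx_inv.
have uA' : A^T \in unitmx by rewrite unitmx_tr.
split=> [->|e]; first by rewrite mulmxKV // mulmxKV.
by rewrite -{1}e mulmxK // mulmxK.
Qed.

Lemma Shat_tauP z : Shat_tau z ->
  [/\ lg_gal z = false, is_diag_mx (lg_mx z) & theta (lg_mx z) = lg_mx z].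
Proof.
move=> [[gz dz] cz]; rewrite /Ghat /= in gz; split=> //.
by have := congr1 (@lg_mx C n) cz; rewrite /= gz /= mulmx1 mul1mx => <-.
Qed.

Lemma sign_rev (i : 'I_n) : (-1) ^+ rev_ord i = (-1) ^+ n.-1 * (-1) ^+ i :> C.
Proof.
rewrite -exprD -signr_odd -[RHS]signr_odd; congr (_ ^+ nat_of_bool _).
case: n i => [[]//|k] i /=.
by rewrite subSS oddB ?oddD // -ltnS.
Qed.

Lemma Shat_tau_rev z i : Shat_tau z ->
  lg_mx z i i * lg_mx z (rev_ord i) (rev_ord i) = 1.
Proof.
move=> /Shat_tauP [_ dz /esym /(theta_eqP _ (lg_unit z))].
have -> : (lg_mx z)^T = lg_mx z.
  by have /diag_mxP [a ->] := dz; rewrite tr_diag_mx.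
rewrite pinJE diag_antidiag //; have /diag_mxP [a ->] := dz.
rewrite mul_mx_diag => /matrixP /(_ i (rev_ord i)); rewrite !mxE !eqxx !mulr1n.
have s0 : (-1) ^+ i != 0 :> C by rewrite signr_eq0.
by move=> e; apply: (mulIf s0); rewrite mul1r -[RHS]e mulrAC.
Qed.

(* A monomial matrix over w centralizing z tau is diagonal, by regularity. *)
Lemma regular_weyl_trivial z w : Shat_tau z ->
  centralizer_hat [set (z * lg_tau C n)%g] = @Shat_tau C n ->
  (forall i, w (rev_ord i) = rev_ord (w i)) ->
  (forall i, lg_mx z (w i) (w i) ^+ 2 = lg_mx z i i ^+ 2) -> w = 1%g.
Proof.
move=> hz cent w_rev w_sq; have [gz dz tz] := Shat_tauP hz.
pose a i := lg_mx z i i.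
have aV i : a i * a (rev_ord i) = 1 by exact: Shat_tau_rev.
have a0 i : a i != 0.
  by apply: contra_eq_neq (aV i) => ->; rewrite mul0r eq_sym oner_eq0.
have aVE i : a (rev_ord i) = (a i)^-1 by apply: (mulfI (a0 i)); rewrite aV divff.
(* The value [c i * c (rev_ord i)] must take for m to preserve z J; the sign compensates the
   alternating entries of [pinJ]. *)
pose ka i : C := (-1) ^+ (w i + i) * (a (w i) / a i).
have ka0 i : ka i != 0 by rewrite mulf_neq0 ?signr_eq0 // mulf_neq0 ?invr_eq0.
(* Reversal inverts the quotient [a (w i) / a i], whose square is 1 by hypothesis. *)
have ka_rev i : ka (rev_ord i) = ka i.
  rewrite /ka w_rev; congr (_ * _).
    by rewrite !exprD !sign_rev mulrACA sqr_sign mul1r.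
  rewrite !aVE invrK; apply/eqP; rewrite mulrC eqr_div //.
  by rewrite -!expr2 eq_sym; apply/eqP/w_sq.
have /choice [sq sqP] : forall x : C, exists y, y ^+ 2 = x.
  move=> x; have [|y] := @solve_monicpoly C 2 (fun i => if i == 0%N then x else 0) => //.
  by rewrite big_ord_recl big_ord_recl big_ord0 /= expr0 mulr1 mul0r !addr0; exists y.
(* Each pair of opposite indices carries its value on the smaller one; a middle index, which is its
   own opposite, takes a square root. *)
pose c (i : 'I_n) := if (i < rev_ord i)%N then ka i
  else if (rev_ord i < i)%N then 1 else sq (ka i).
have cc i : c i * c (rev_ord i) = ka i.
  rewrite /c rev_ordK; case: ltngtP => [_|_|/val_inj e]; rewrite ?mulr1 ?mul1r //.
  by rewrite -e -expr2 sqP.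
have c0 i : c i != 0.
  by apply: contraNneq (ka0 i) => e; rewrite -cc e mul0r.
have ezJ : lg_mx z *m J = antidiag_mx (fun i => a i * (-1) ^+ i).
  by rewrite pinJE diag_antidiag.
pose m := monomial_mx w c.
have mz : m *m (lg_mx z *m J) *m m^T = lg_mx z *m J.
  rewrite ezJ; apply: monomial_conj => // i; rewrite cc /ka exprD.
  rewrite -!mulrA [_^-1 * _]mulrA mulVf // mul1r.
  rewrite [(-1) ^+ i * _]mulrCA -expr2 sqrr_sign mulr1 mulrC //.
have uzJ : lg_mx z *m J \in unitmx by rewrite unitmx_mul lg_unit pinJ_unit.
have um : m \in unitmx.
  have : m *m (lg_mx z *m J) *m m^T \in unitmx by rewrite mz.
  by rewrite !unitmx_mul -andbA => /andP [].
have thm : m *m lg_mx z = lg_mx z *m theta m.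
  have uz := lg_unit z.
  rewrite -[LHS](mulKVmx uz); congr (_ *m _); apply/(theta_eqP _ um).
  rewrite -!mulmxA -[RHS](mulKmx uz); congr (_ *m _).
  by rewrite -[RHS]mz !mulmxA.
have : centralizer_hat [set (z * lg_tau C n)%g] (@MkLG C n m false um).
  split=> // _ ->; apply: LG_eq; rewrite /= gz //=.
  by rewrite !mulmx1.
rewrite cent => /Shat_tauP [_ /= /is_diag_mxP dm _].
apply/permP => i; rewrite perm1; apply/eqP/negPn/negP => ne.
by have := dm _ _ ne; rewrite mxE eqxx => /eqP; rewrite (negPf (c0 i)).
Qed.

End RegularElements.

(** * Galois action on characters *)

Section CharacterAction.
Variables (R : realType) (L : closedFieldType) (abs : L -> R) (p n : nat).
Hypothesis absP : padic_closure abs p.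
Hypothesis p_prime : prime p.
Local Notation gal := (fieldAut L).
Variables (K E : set L) (tau : gal) (H : 'M[L]_n) (rhoS : gal -> 'M[int]_n).
Hypothesis HP : witt_gram E tau H.
Hypothesis rhoSP : XS_action abs p K E H rhoS.

(** The map e_i |-> - e_(n-1-i), by which Weil elements nontrivial on E act on the characters of
    S. *)
Definition neg_rev_mx : 'M[int]_n := \matrix_(i, j) (if j == rev_ord i then -1 else 0).

Lemma neg_rev_mxE (l : 'cV[int]_n) i : (neg_rev_mx *m l) i 0 = - l (rev_ord i) 0.
Proof.
rewrite mxE (bigD1 (rev_ord i)) //= big1 ?addr0 => [|j ne]; rewrite mxE.
  by rewrite eqxx mulN1r.
by rewrite (negPf ne) mul0r.
Qed.

Lemma neg_rev_mx_sq : neg_rev_mx *m neg_rev_mx = 1%:M.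
Proof.
apply/matrixP => i j; rewrite mxE (bigD1 (rev_ord i)) //= big1 ?addr0 => [|k ne].
  by rewrite !mxE eqxx rev_ordK eq_sym; case: eqP; rewrite ?mulr0 ?mulrNN ?mulr1.
by rewrite mxE (negPf ne) mul0r.
Qed.

Lemma mulmx_inj (A B : 'M[int]_n) : (forall l : 'cV[int]_n, A *m l = B *m l) -> A = B.
Proof.
move=> h; apply/matrixP => i j; have := h (delta_mx j 0).
by rewrite -!colE => /matrixP /(_ i 0); rewrite !mxE.
Qed.

Let point (k : 'I_n) (x : L) : 'rV[L]_n := \row_i (if i == k then x else 1).

Lemma diag_char_point k x l : diag_char (point k x) l = x ^ (l k 0).
Proof.
rewrite /diag_char (bigD1 k) //= big1 ?mulr1 => [|i ne]; rewrite mxE ?eqxx //.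
by rewrite (negPf ne) exp1rz.
Qed.

Lemma padic_p_neq0 : p%:R != 0 :> L. Proof. exact/(natr_neq0 absP p_prime)/prime_gt0. Qed.

(** p is fixed by every automorphism and its powers have distinct absolute values, so characters can
    be recovered from their values at points with entries p and 1. *)
Lemma exprzp_inj : injective (fun k : int => (p%:R : L) ^ k).
Proof.
have absZ (k : int) : abs (p%:R ^ k) = abs p%:R ^ k.
  case: k => k; rewrite ?NegzE -?exprnN -?exprnP ?(absV absP) (absX absP) //.
move=> k k' /(congr1 abs); rewrite !absZ; apply: ieexprIz.
  exact: absp_gt0 absP p_prime.
by rewrite lt_eqF // (absp_lt1 absP).
Qed.

Lemma witt_gram_unit : H \in unitmx.
Proof.
have [_ H0 _] := HP.
have : H *m \matrix_(i, j) (if j == rev_ord i then (H (rev_ord i) i)^-1 else 0) = 1%:M.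
  apply/matrixP => i j; rewrite mxE (bigD1 (rev_ord i)) //= big1 ?addr0 => [|k ne].
    rewrite !mxE rev_ordK eq_sym; case: eqP => [_|]; last by rewrite mulr0.
    by rewrite divff // H0.
  have /negbFE /eqP -> : (H i k != 0) = false by rewrite H0 (negPf ne).
  by rewrite mul0r.
by case/mulmx1_unit.
Qed.

Lemma point_neq0 k x i : x != 0 -> point k x 0 i != 0.
Proof. by move=> x0; rewrite mxE; case: ifP; rewrite ?oner_neq0. Qed.

Lemma XS_action_fixes s : weil abs p K s -> fixes E s -> rhoS s = 1%:M.
Proof.
move=> Ws fs; apply: mulmx_inj => l; apply/matrixP => k j; rewrite ord1 mul1mx.
apply: exprzp_inj; rewrite -!diag_char_point.
have := rhoSP Ws (d := point k p%:R) (d' := point k p%:R)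
  (fun i => point_neq0 k i padic_p_neq0) _ l.
rewrite diag_char_point [X in _ -> _ = X]/= diag_char_point fmorphXz rmorph_nat; apply.
rewrite /unitary_act asboolT //; apply/matrixP => i i'; rewrite !mxE.
by case: (i == i'); rewrite ?rmorph0 // !mulr1n; case: ifP; rewrite ?rmorph1 ?rmorph_nat.
Qed.

Lemma XS_action_moves s : weil abs p K s -> ~ fixes E s -> rhoS s = neg_rev_mx.
Proof.
move=> Ws fs; apply: mulmx_inj => l; apply/matrixP => k j; rewrite ord1 neg_rev_mxE.
apply: exprzp_inj; have pV0 : p%:R^-1 != 0 :> L by rewrite invr_eq0 padic_p_neq0.
(* The twisted action inverts and reverses: p^-1 at the opposite index becomes p at k. *)
have := rhoSP Ws (d := point (rev_ord k) p%:R^-1) (d' := point k p%:R)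
  (fun i => point_neq0 (rev_ord k) i pV0) _ l.
rewrite !diag_char_point fmorphXz fmorphV rmorph_nat exprz_inv; apply.
rewrite /unitary_act asboolF //; have uH := witt_gram_unit.
have [_ H0 _] := HP.
have -> : invmx (map_mx s (diag_mx (point (rev_ord k) p%:R^-1)))^T =
    diag_mx (point (rev_ord k) p%:R).
  apply: invmx_uniq; rewrite map_diag_mx tr_diag_mx mulmx_diag.
  apply/matrixP => i i'; rewrite !mxE.
  case: (i == i') => //; rewrite !mulr1n.
  by case: ifP => _; rewrite ?rmorph1 ?mul1r // fmorphV rmorph_nat mulVf ?padic_p_neq0.
apply: (can_inj (mulmxK uH)); rewrite mulmxKV // mul_diag_mx mul_mx_diag.
apply/matrixP => i i'; rewrite !mxE mulrC.
have [e|ne] := eqVneq i' (rev_ord i); first by rewrite e (inj_eq rev_ord_inj).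
have /negbFE /eqP -> : (H i i' != 0) = false by rewrite H0 (negPf ne).
by rewrite !mul0r.
Qed.

End CharacterAction.

(** * The torus over the maximal unramified subextension *)

Section UnramifiedDescent.
Variables (R : realType) (L : closedFieldType) (abs : L -> R) (p n : nat).
Hypothesis absP : padic_closure abs p.
Hypothesis p_prime : prime p.
Local Notation gal := (fieldAut L).
Variables (geom : bool) (rec : set L -> gal -> L).
Hypothesis recP : reciprocity abs p geom rec.
Variables (K M : set L) (tau : gal) (rho : gal -> 'M[int]_n).
Hypothesis pK : padic_field abs K.
Hypothesis tau_inertia : inertia abs K tau.
Hypothesis rhoM : forall s t, weil abs p K s -> weil abs p K t ->
  rho (s * t)%g = rho s *m rho t.
Hypothesis rho_inertia : forall s, inertia abs K s -> rho s = 1%:M \/ rho s = rho tau.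
Hypothesis rho1 : rho 1%g = 1%:M.
Hypothesis rho_tau_sq : rho tau *m rho tau = 1%:M.
Hypothesis rho_tau_neq1 : rho tau <> 1%:M.
Hypothesis splitM : splitting_field abs p rho K M.

Local Notation WK := (weil abs p K).
Local Notation WM := (weil abs p M).
Local Notation Kf := (max_unramified abs K M).
Local Notation WKf := (weil abs p Kf).

Let KM : K `<=` M. Proof. by case: splitM. Qed.
Let pM : padic_field abs M. Proof. by case: splitM. Qed.
Let sM : is_subfield M. Proof. by case: pM. Qed.
Let QK : Qp abs `<=` K. Proof. by case: pK. Qed.
Let WV N s : weil abs p N s -> weil abs p N (s^-1)%g. Proof. exact: weilV. Qed.
Let WM_ N s t : weil abs p N s -> weil abs p N t -> weil abs p N (s * t)%g.
Proof. exact: weilM. Qed.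
Let tauW : WK tau. Proof. exact: inertia_weil. Qed.

Lemma weil_splitP s : WK s -> (WM s <-> rho s = 1%:M).
Proof.
have [_ _ h] := splitM; move=> Ws; rewrite -(h s Ws).
by split=> [[]//|fs]; exact: weil_fixes Ws fs.
Qed.

Lemma rho_inv_mul s : WK s -> rho (s^-1)%g *m rho s = 1%:M.
Proof. by move=> Ws; rewrite -rhoM ?mulVg //; exact: WV. Qed.

(** W_M is the kernel of [rho] on W_K, hence normal; so s x is fixed by W_M and lies in M. *)
Lemma split_stable s x : WK s -> M x -> M (s x).
Proof.
move=> Ws Mx; apply: (weil_fixed_field absP p_prime recP pM) => t Wt.
have WtK : WK t := weil_sub KM Wt.
have Wc : WK (s^-1 * t * s)%g by apply: WM_ => //; apply: WM_ => //; exact: WV.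
have [fc _] : WM (s^-1 * t * s)%g.
  apply/(weil_splitP Wc); rewrite !rhoM //; [|exact: WV|apply: WM_ => //; exact: WV].
  by have /(weil_splitP WtK) -> := Wt; rewrite mulmx1 rho_inv_mul.
by have := congr1 s (fc x Mx); rewrite !aut_mulE aut_mulEV.
Qed.

Lemma rho_eq_fixes s t : WK s -> WK t -> rho s = rho t -> forall x, M x -> s x = t x.
Proof.
move=> Ws Wt est x Mx; have Wc : WK (t^-1 * s)%g by apply: WM_ => //; exact: WV.
have [fc _] : WM (t^-1 * s)%g.
  by apply/(weil_splitP Wc); rewrite rhoM ?est ?rho_inv_mul //; exact: WV.
by have := congr1 t (fc x Mx); rewrite aut_mulE aut_mulEV.
Qed.

Lemma tau_tau x : M x -> tau (tau x) = x.
Proof.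
move=> Mx; rewrite -aut_mulE (rho_eq_fixes (t := 1%g)) //; [exact: WM_|exact: weil1|].
by rewrite rhoM // rho_tau_sq rho1.
Qed.

Lemma unramifiedP x : M x -> (Kf x <-> tau x = x).
Proof.
move=> Mx; split=> [[_ h]|tx]; first exact: h.
split=> // s Is; have Ws := inertia_weil absP p_prime Is.
have [e|e] := rho_inertia Is.
  by rewrite (rho_eq_fixes Ws (weil1 absP p_prime K)) // rho1.
by rewrite (rho_eq_fixes Ws tauW).
Qed.

Lemma unramified_subfield : is_subfield Kf.
Proof.
split; first by split=> [|s _]; [exact: subfield1 | exact: rmorph1].
move=> x y [Mx hx] [My hy]; split; split=> [|s Is].
- exact: subfieldB.
- by rewrite rmorphB /= hx ?hy.
- exact: subfield_div.
by rewrite fmorph_div /= hx ?hy.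
Qed.

Lemma unramified_sub : K `<=` Kf.
Proof. by move=> x Kx; split=> [|s [fs _]]; [exact: KM | exact: fs]. Qed.

Lemma unramified_fixed x : (forall s, WKf s -> s x = x) -> Kf x.
Proof.
move=> hx; split=> [|s Is].
  apply: (weil_fixed_field absP p_prime recP pM) => s Ws; apply: hx.
  by apply: weil_sub Ws => y [].
by apply: hx; apply: weil_fixes (inertia_weil absP p_prime Is) _ => y [_]; apply.
Qed.

(* s permutes the roots of (X - x)(X - tau x), whose coefficients are in K_f;
   and M is not the union of the proper subgroups {s x = x} and
   {s x = tau x}. *)
Lemma rho_unramified s : WKf s -> rho s = 1%:M \/ rho s = rho tau.
Proof.
move=> Wf; have Ws : WK s := weil_sub unramified_sub Wf; have [fs _] := Wf.
have root x : M x -> s x = x \/ s x = tau x.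
  move=> Mx; have Mt := split_stable tauW Mx.
  have s1 : s (x + tau x) = x + tau x.
    apply: fs; apply/unramifiedP; first exact: subfieldD.
    by rewrite rmorphD /= tau_tau // addrC.
  have s2 : s (x * tau x) = x * tau x.
    apply: fs; apply/unramifiedP; first exact: subfieldM.
    by rewrite rmorphM /= tau_tau // mulrC.
  have : (s x - x) * (s x - tau x) = 0.
    transitivity (s x * s x - s x * (x + tau x) + x * tau x); first by ring.
    by rewrite -{1}s1 -{1}s2 rmorphD rmorphM /=; ring.
  move=> /eqP; rewrite mulf_eq0 !subr_eq0 => /orP [/eqP ->|/eqP ->]; [by left | by right].
have [h1|/existsNP [x /not_implyP [Mx hx]]] := pselect (forall x, M x -> s x = x).
  by left; apply/(weil_splitP Ws); exact: weil_fixes Ws h1.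
right; have sx : s x = tau x by case: (root x Mx).
have htau y : M y -> s y = tau y.
  move=> My; case: (root y My) => // sy.
  case: (root (x + y)); rewrite ?rmorphD /= ?sx ?sy; first exact: subfieldD.
    by move=> /addIr e; case: hx; rewrite sx.
  by move=> /addrI.
have Wc : WK (tau^-1 * s)%g by apply: WM_ => //; exact: WV.
have : rho (tau^-1 * s)%g = 1%:M.
  apply/(weil_splitP Wc); apply: weil_fixes Wc _ => y My.
  by rewrite aut_mulE htau // aut_mulVE.
rewrite rhoM //; last exact: WV.
move=> e; have h : rho tau *m rho (tau^-1)%g = 1%:M.
  by rewrite -rhoM ?mulgV //; exact: WV.
by rewrite -[rho s]mul1mx -h -mulmxA e mulmx1.
Qed.

Lemma tau_unramified : WKf tau.
Proof. by apply: weil_fixes tauW _ => x [_]; apply. Qed.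

Lemma tau_sq_split : WM (tau * tau)%g.
Proof. by apply/weil_splitP; [exact: WM_ | rewrite rhoM]. Qed.

Lemma unramified_transversal : Defs.transversal WKf WM [:: 1%g; tau].
Proof.
split=> [r|g Wg].
  rewrite !inE => /orP [/eqP ->|/eqP ->]; [exact: weil1 | exact: tau_unramified].
have Wk : WK g := weil_sub unramified_sub Wg.
have WMV : WM (tau^-1 * g)%g <-> rho g = rho tau.
  have Wc : WK (tau^-1 * g)%g by apply: WM_ => //; exact: WV.
  rewrite (weil_splitP Wc) rhoM //; last exact: WV.
  split=> [e|->]; last exact: rho_inv_mul.
  have h : rho tau *m rho (tau^-1)%g = 1%:M.
    by rewrite -rhoM ?mulgV //; exact: WV.
  by rewrite -[rho g]mul1mx -h -mulmxA e mulmx1.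
have WM1 : WM (1^-1 * g)%g <-> rho g = 1%:M by rewrite invg1 mul1g; exact: weil_splitP.
have i2 (i : 'I_2) : i = ord0 \/ i = ord_max.
  by case: i => [[|[|//]]] hi; [left | right]; apply: val_inj.
have [e|e] := rho_unramified Wg.
  exists ord0; split=> [|i]; first by apply/WM1.
  have [->|->] // := i2 i; move=> /= /WMV e'.
  by case: rho_tau_neq1; rewrite -e' e.
exists ord_max; split=> [|i]; first by apply/WMV.
have [->|->] // := i2 i; move=> /= /WM1 e'.
by case: rho_tau_neq1; rewrite -e e'.
Qed.

Local Notation u := (rec M (tau * tau)%g).

Lemma abs_norm_lt1 rs v : Defs.transversal (weil abs p (Qp abs)) WM rs -> abs v < 1 ->
  abs (\prod_(r <- rs) (r : gal) v) < 1.
Proof.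
move=> [rW rP] v1; have [i _] := rP 1%g (weil1 absP p_prime _).
have rlt r : r \in rs -> abs (r v) < 1.
  by move=> /rW Wr; rewrite (weil_unitE absP p_prime _ Wr).
case: rs {rW rP} i rlt => [[]//|r rs] _ rlt; rewrite big_cons mulrC.
rewrite (absM_lt1 absP) //; last by rewrite rlt ?mem_head.
rewrite big_seq; apply: (big_ind (fun x => abs x <= 1)) => [|x y|r' hr'].
- by rewrite (absZ1 absP).
- exact: (absM_le1 absP).
by rewrite ltW // rlt // inE hr' orbT.
Qed.

(** The norm of u to Q_p is the reciprocity image of tau^2, of absolute value 1. If |u| differed
    from 1, all conjugates of u, or all those of its inverse, would lie in the maximal ideal, and so
    would their product. *)
Lemma rec_tau_sq_unit : abs u = 1.
Proof.
have pQ := Qp_padic absP p_prime; have QM : Qp abs `<=` M by case: pM.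
have sQQ : subgroup WM := weil_subgroup absP p_prime M.
have [rs rsP] := weil_transversal absP p_prime (N := Qp abs) (fun x h => h) pM sQQ
  (fun s Ws fs => weil_fixes Ws fs).
have WQ : weil abs p (Qp abs) (tau * tau)%g := weil_sub QM tau_sq_split.
have eN := rec_norm recP pQ pM QM rsP tau_sq_split.
have N1 : abs (rec (Qp abs) (tau * tau)%g) = 1.
  (* The Frobenius exponent is 0, so both normalizations of reciprocity give the same value. *)
  rewrite (rec_frob recP pQ (Qp_residue_card absP p_prime)
    (Qp_uniformizer absP p_prime) WQ (k := 0)); first by case: geom.
  move=> x x1; have [_ h] := inertiaM absP p_prime tau_inertia tau_inertia.
  exact: (h x x1).
have u0 : u != 0 by have [] := rec_mem recP pM tau_sq_split.
apply/le_anti; rewrite !leNgt; apply/andP; split; apply/negP => h.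
  have h' : abs u^-1 < 1 by rewrite (absV absP) invf_lt1 // (abs_gt0 absP).
  have := abs_norm_lt1 rsP h'.
  rewrite (eq_bigr (fun r : gal => (r u)^-1)) => [|r _]; last exact: fmorphV.
  by rewrite prodfV -eN (absV absP) N1 invr1 ltxx.
by have := abs_norm_lt1 rsP h; rewrite -eN N1 ltxx.
Qed.

(** Reciprocity is compatible with conjugation, and tau commutes with tau^2 and preserves M. *)
Lemma tau_rec : tau u = u.
Proof.
have fQ : fixes (Qp abs) tau by move=> x /QK; case: tau_inertia => h _; exact: h.
have <- := rec_conj recP pM fQ tau_sq_split.
have -> : [set tau x | x in M] = M.
  apply/seteqP; split=> [_ [x Mx <-]|x Mx]; first exact: split_stable.
  by exists (tau x); [exact: split_stable | exact: tau_tau].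
by rewrite mulgA mulgK.
Qed.

Lemma rec_unramified : Kf u.
Proof.
by apply/unramifiedP; [have [] := rec_mem recP pM tau_sq_split | exact: tau_rec].
Qed.

(** tau^2 preserves both cosets 1 W_M and tau W_M. Each contributes reciprocity of tau^2, with
    exponents x and x rho(tau) respectively. *)
Lemma transfer_tau_sq (x : 'rV[int]_n) :
  transfer_point abs p rho rec M [:: 1%g; tau] [:: ((tau * tau)%g, x)] =
    fun l => u ^ (((x + x *m rho tau) *m l) 0 0).
Proof.
apply/funext => l; rewrite /transfer_point big_seq1 /= !big_cons big_nil mulr1.
have r1 : coset_rep WM [:: 1%g; tau] (tau * tau * 1)%g = 1%g.
  by rewrite /coset_rep /= invg1 mul1g mulg1 asboolT //; exact: tau_sq_split.
have r2 : coset_rep WM [:: 1%g; tau] (tau * tau * tau)%g = tau.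
  have Wt : WK (tau * tau * tau)%g by apply: WM_ => //; exact: WM_.
  rewrite /coset_rep /= invg1 mul1g asboolF; last first.
    by move/(weil_splitP Wt); rewrite !rhoM //; [rewrite rho_tau_sq mul1mx | exact: WM_].
  by rewrite /= !mulgA mulVg mul1g asboolT //; exact: tau_sq_split.
rewrite r1 r2 invg1 mul1g mulg1 !mulgA mulVg mul1g rho1 mulmx1 -expfzDr.
  by rewrite mulmxDl; congr (_ ^ _); rewrite [RHS]mxE.
by have [] := rec_mem recP pM tau_sq_split.
Qed.

Lemma invariant_cochar (x : 'rV[int]_n) s : WKf s ->
  (x + x *m rho tau) *m rho s = x + x *m rho tau.
Proof.
move=> /rho_unramified [] ->; first by rewrite mulmx1.
by rewrite mulmxDl -mulmxA rho_tau_sq mulmx1 addrC.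
Qed.

(** The correspondence computes the character of T(K_f); chi is tied to it only on T(K_f)^0, so the
    point must first be placed there. *)
Lemma character_norm (C : fieldType) (a : gal -> 'I_n -> C)
    (chi chif : ('cV[int]_n -> L) -> C) rs (x : 'rV[int]_n) :
  Defs.transversal WK WKf rs ->
  torus_LLC abs p rho rec Kf M a chif ->
  (forall t, torus_points0 abs p rho Kf t -> chi (torus_norm rho rs t) = chif t) ->
  chi (torus_norm rho rs (fun l => u ^ (((x + x *m rho tau) *m l) 0 0))) =
    \prod_(k < n) a (tau * tau)%g k ^ (x 0 k).
Proof.
move=> rsP [_ llc] chiN; set t := fun l => _.
have uf s : WKf s -> s u = u by case=> fs _; apply/fs/rec_unramified.
have rhoMf s s' : WKf s -> WKf s' -> rho (s * s')%g = rho s *m rho s'.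
  by move=> h h'; apply: rhoM; exact: (weil_sub unramified_sub).
have T0 : torus_points0 abs p rho Kf t.
  (* Viewing t as its own norm for the trivial extension makes the result on norms apply with both
     fields equal to K_f. *)
  have -> : t = torus_norm rho [:: 1%g] t.
    by apply/funext => l; rewrite /torus_norm big_seq1 invg1 rho1 mul1mx.
  apply: (torus_norm_point0 absP p_prime unramified_subfield unramified_fixed
    (N' := Kf)) => //.
  - exact: rec_tau_sq_unit.
  - exact: invariant_cochar.
  - exact: weil_transversal1.
rewrite chiN // /t -transfer_tau_sq (llc _ _ unramified_transversal).
  by rewrite big_seq1.
split=> [e|]; first by rewrite inE => /eqP -> /=; apply: weil_sub tau_sq_split => y [].
by rewrite big_seq1 /= rhoM // rho_tau_sq mulmx1 subrr.
Qed.

Lemma norm_in_points0 rs (x : 'rV[int]_n) : Defs.transversal WK WKf rs ->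
  torus_points0 abs p rho K
    (torus_norm rho rs (fun l => u ^ (((x + x *m rho tau) *m l) 0 0))).
Proof.
move=> rsP; apply: (torus_norm_point0 absP p_prime _ _ unramified_sub) rsP => //.
- by case: pK.
- by move=> y; exact: (weil_fixed_field absP p_prime recP pK).
- exact: rec_tau_sq_unit.
- by move=> s [fs _]; apply/fs/rec_unramified.
- exact: invariant_cochar.
Qed.

Lemma unramified_transversal_exists : exists rs, Defs.transversal WK WKf rs.
Proof.
apply: (weil_transversal absP p_prime QK pM (weil_subgroup absP p_prime _)).
by move=> s Ws fs; apply: weil_fixes Ws _ => x [Mx _]; exact: fs.
Qed.

End UnramifiedDescent.

(** * Permutation matrices and their commutation relations *)

Section WeylMatrices.
Variable n : nat.
Implicit Types (w : 'S_n) (A B : 'M[int]_n).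

(** The order is reversed because permutations compose from left to right while matrices act on
    columns. *)
Lemma weyl_mxM w w' : weyl_mx w *m weyl_mx w' = weyl_mx (w' * w)%g.
Proof.
apply/matrixP => i k; rewrite mxE (bigD1 (w' k)) //= big1 ?addr0 => [|j ne].
  by rewrite !mxE eqxx mulr1 permM.
by rewrite !mxE (negPf ne) mulr0.
Qed.

Lemma weyl_mx1 : weyl_mx (1%g : 'S_n) = 1%:M.
Proof. by apply/matrixP => i j; rewrite !mxE perm1. Qed.

Lemma weyl_mx_rev w : weyl_mx w *m neg_rev_mx n = neg_rev_mx n *m weyl_mx w ->
  forall i, w (rev_ord i) = rev_ord (w i).
Proof.
move=> /matrixP e i; have := e (w (rev_ord i)) i; rewrite !mxE.
rewrite (bigD1 (rev_ord i)) //= [X in _ + X]big1 ?addr0 => [|j ne]; last first.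
  by rewrite !mxE [i == _]eq_sym (can2_eq rev_ordK rev_ordK) (negPf ne) mulr0.
rewrite (bigD1 (rev_ord (w (rev_ord i)))) //= [X in _ = _ + X]big1 ?addr0 => [|j ne].
  rewrite !mxE !eqxx rev_ordK eqxx; case: eqP => [<- _|//]; by rewrite rev_ordK.
by rewrite !mxE (negPf ne) mul0r.
Qed.

Lemma commute_inv_mx A B W : A *m B = 1%:M -> W *m A = A *m W ->
  W *m B = B *m W :> 'M[int]_n.
Proof.
move=> AB WA; have BA := mulmx1C AB.
by rewrite -[LHS]mul1mx -BA -!mulmxA [A *m _]mulmxA -WA -!mulmxA AB mulmx1.
Qed.

Lemma neg_rev_mx_neq1 : (0 < n)%N -> neg_rev_mx n <> 1%:M.
Proof.
move=> n0 e; have := neg_rev_mxE (const_mx 1) (Ordinal n0).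
by rewrite e mul1mx !mxE.
Qed.

End WeylMatrices.

Theorem proposition9p1
  (R : realType) (p : nat) (L : closedFieldType) (abs : L -> R)
  (K E : set L) (q n : nat) (tau Fr : fieldAut L) (H : 'M[L]_n)
  (geom : bool) (rec : set L -> fieldAut L -> L)
  (phi : fieldAut L -> LG R[i] n) (z : LG R[i] n) (omega : 'S_n)
  (rhoS rhoT : fieldAut L -> 'M[int]_n) (M : set L)
  (chi : ('cV[int]_n -> L) -> R[i]) :
  prime p -> p != 2%N -> padic_closure abs p ->
  ramified_quadratic abs K E -> residue_card abs K q ->
  tame_inertia_generator abs K tau -> ~ fixes E tau ->
  weil abs p K Fr -> frob_pow abs q Fr 1 -> fixes E Fr ->
  reciprocity abs p geom rec ->
  (0 < n)%N -> witt_gram E tau H -> XS_action abs p K E H rhoS ->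
  langlands_parameter abs p K E phi ->
  tame_parameter abs K phi -> discrete_parameter abs p K phi ->
  regular_parameter tau phi ->
  Shat_tau z -> phi tau = (z * lg_tau R[i] n)%g ->
  weyl_image (phi Fr) omega ->
  centralizer_hat [set phi tau] = @Shat_tau R[i] n ->
  XT_action abs p K rhoS rhoT Fr omega -> splitting_field abs p rhoT K M ->
  parameter_character abs p rhoT rec K M phi chi ->
  forall w : 'S_n,
    weyl_inertia_fixed abs K rhoT w -> commute w omega ->
    (forall t, torus_points0 abs p rhoT K t -> chi (weyl_act w t) = chi t) ->
    w = 1%g.
Proof.
move=> p_prime _ absP [[pK _] KE _ _] Kq [tau_in _] tauE WFr FrF _ recP n0 HP XS.
move=> [phiM _ _] _ _ _ hz ephi _ cent [rhoM rhoI rhoFr] splitM [_ [chif [llc chiN]]].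
move=> w wI wo chiw.
have Wtau : weil abs p K tau := inertia_weil absP p_prime tau_in.
have I1 : inertia abs K 1%g by apply/inertiaP; split=> //; exact: (frob_ratio1 absP).
have rhoIE s : inertia abs K s ->
    (fixes E s -> rhoT s = 1%:M) /\ (~ fixes E s -> rhoT s = neg_rev_mx n).
  move=> Is; have Ws := inertia_weil absP p_prime Is; rewrite rhoI //.
  split; first exact: (XS_action_fixes absP p_prime XS).
  exact: (XS_action_moves absP p_prime HP XS).
have rtau : rhoT tau = neg_rev_mx n by have [_ ->] := rhoIE _ tau_in.
have rho1 : rhoT 1%g = 1%:M by have [-> //] := rhoIE _ I1.
have rho_in s : inertia abs K s -> rhoT s = 1%:M \/ rhoT s = rhoT tau.
  move=> /rhoIE [h1 h2]; rewrite rtau.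
  by have [/h1|/h2] := pselect (fixes E s); [left | right].
have rtau2 : rhoT tau *m rhoT tau = 1%:M by rewrite rtau neg_rev_mx_sq.
have rtau1 : rhoT tau <> 1%:M by rewrite rtau; exact: neg_rev_mx_neq1.
have w_rev : forall i, w (rev_ord i) = rev_ord (w i).
  by apply: weyl_mx_rev; rewrite -rtau; exact: wI.
pose W : 'M[int]_n := weyl_mx (w^-1)%g.
(* Inertia commutes with w by hypothesis and Fr because w commutes with omega; their products
   exhaust the Weil group. *)
have Wcomm s : weil abs p K s -> W *m rhoT s = rhoT s *m W.
  have wW : weyl_mx w *m W = 1%:M by rewrite weyl_mxM mulVg weyl_mx1.
  suff h : weil abs p K s -> rhoT s *m weyl_mx w = weyl_mx w *m rhoT s.
    by move=> Ws; apply/esym/(commute_inv_mx wW)/h.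
  have hFr m : rhoT (Fr ^+ m)%g *m weyl_mx w = weyl_mx w *m rhoT (Fr ^+ m)%g.
    elim: m => [|m ih]; first by rewrite expg0 rho1 mul1mx mulmx1.
    rewrite expgS rhoM //; last exact: weilX.
    rewrite -mulmxA ih !mulmxA; congr (_ *m _).
    by rewrite rhoFr !weyl_mxM wo.
  have [sK _ _] := pK.
  move=> /(weil_generation absP p_prime Kq WFr FrF sK) [i [m [k [Ii ->]]]].
  have Wi := inertia_weil absP p_prime Ii.
  have WX j : weil abs p K (Fr ^+ j)%g by exact: weilX.
  have WV : weil abs p K (Fr ^+ k)^-1%g by exact: weilV.
  have eV : rhoT (Fr ^+ k)^-1%g *m weyl_mx w = weyl_mx w *m rhoT (Fr ^+ k)^-1%g.
    apply/esym/(commute_inv_mx (A := rhoT (Fr ^+ k)%g)); last by rewrite hFr.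
    by rewrite -rhoM // mulgV.
  rewrite !rhoM //; last exact: weilM.
  by rewrite -mulmxA eV !mulmxA; congr (_ *m _); rewrite -mulmxA hFr !mulmxA wI.
have [rs rsP] := unramified_transversal_exists absP p_prime pK splitM.
have chiE := character_norm absP p_prime recP pK tau_in rhoM rho_in rho1 rtau2 rtau1
  splitM _ rsP llc (fun t => chiN rs t rsP).
(* Since W commutes with the action, w carries the norm point of x to that of x W, and invariance of
   chi equates the two pairings with phi(tau^2). *)
have inv (x : 'rV[int]_n) :
    \prod_(k < n) lg_mx (phi (tau * tau)%g) k k ^ ((x *m W) 0 k) =
    \prod_(k < n) lg_mx (phi (tau * tau)%g) k k ^ (x 0 k).
  rewrite -!chiE -[RHS]chiw; last first.
    exact: (norm_in_points0 absP p_prime recP pK tau_in rhoM rho_in rho1 rtau2 splitM _ rsP).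
  congr chi; apply/funext => l; rewrite /weyl_act /torus_norm -/W.
  rewrite [LHS]big_seq [RHS]big_seq; apply: eq_bigr => r rrs; congr (r (_ ^ (_ 0 0))).
  have Wr : weil abs p K r^-1%g by apply: weilV => //; case: rsP => h _; exact: h.
  by rewrite [rhoT _ *m (W *m l)]mulmxA -Wcomm // !mulmxA;
    congr (_ *m _ *m _); rewrite mulmxDl -!mulmxA Wcomm.
have phi2 k : lg_mx (phi (tau * tau)%g) k k = lg_mx z k k ^+ 2.
  have [gz /diag_mxP [d ed] tz] := Shat_tauP hz.
  rewrite phiM // ephi /= gz /= mulmx1 tz ed mulmx_diag !mxE eqxx !mulr1n.
  by rewrite expr2.
apply: (regular_weyl_trivial hz _ w_rev) => [|i]; first by rewrite -ephi.
(* Row i of W is the basis vector at w i, so the two pairings are the squares of the entries of z at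
   w i and at i. *)
have := inv (delta_mx 0 i); rewrite -rowE.
have pd (y : 'rV[int]_n) k : (forall j, y 0 j = (j == k)%:R) ->
    \prod_(j < n) lg_mx (phi (tau * tau)%g) j j ^ (y 0 j) = lg_mx z k k ^+ 2.
  move=> hy; rewrite (bigD1 k) //= big1 ?mulr1 ?hy ?eqxx ?phi2 // => j ne.
  by rewrite hy (negPf ne).
rewrite (pd (row i W) (w i)); last first.
  by move=> j; rewrite !mxE eq_sym (can2_eq (permKV w) (permK w)).
by rewrite (pd _ i) // => j; rewrite mxE eqxx.
Qed.
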